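(* Let $n\ge 3$, let $B=B_1(0)$ be the open unit ball of $\mathbb{R}^n$, let $N=\frac{2n}{n-2}$, and let $b>0$. For every compact set $K\subset B$ there exists a positive constant $c=c(n,b,K)$ such that, for every real $\epsilon$ with $0\le\epsilon<\frac{2}{n-2}$, every function $V$ on $B$ with $0\le V(x)\le b$ for $x \in B$, and every solution $u$ of $$\Delta u=V u^{N-1-\epsilon},\quad u>0\ \text{ in } B,\qquad u=0\ \text{ on } \partial B,$$ one has $$\Big(\sup_B u\Big)^{7}\times\inf_K u\ \ge\ c .$$
   Context: $\Delta=-\sum_{i=1}^n\partial_{ii}$ is the geometric (nonnegative) Laplacian. $V$ is a measurable function, with no regularity assumed beyond the bounds. A solution is a function $u\in C^1(\bar B)$ satisfying the equation in the weak sense: $\int_B\nabla u\cdot\nabla\phi\,dx=\int_B V u^{N-1-\epsilon}\phi\,dx$ for all $\phi\in C_0^\infty(B)$, with $u>0$ in $B$ and $u=0$ on $\partial B$. The constant $c$ depends only on $n$, $b$ and $K$, not on $\epsilon$, $V$ or $u$. *)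

(* Defs.v *)
From HB Require Import structures.
From mathcomp Require Import all_boot all_order all_algebra.
From mathcomp Require Import all_classical all_reals all_analysis.
From mathcomp Require Import measurable_realfun.

Set Implicit Arguments.
Unset Strict Implicit.
Unset Printing Implicit Defensive.

Import Order.TTheory GRing.Theory Num.Theory.
Import numFieldNormedType.Exports.

Local Open Scope classical_set_scope.
Local Open Scope ring_scope.

(* R^n is 'rV[R]_n.  Its topology and normed structure are those of the
   library (sup norm, hence the usual topology); the library has no measure on
   it, so Lebesgue measure is built below. *)

Definition coord (R : realType) (n : nat) (i : 'I_n) (x : 'rV[R]_n) :
  measurableTypeR R := x ord0 i.

Definition rV_display : measure_display.
Proof. exact: measure_tuple_display default_measure_display. Qed.

Section rV_measurable.
Context (R : realType) (n : nat).

(* Product sigma-algebra of n copies of the Borel sets of R, i.e. the Borel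
   sets of R^n. *)
Let rVmeas := g_sigma_preimage (@coord R n).

Let rVmeas0 : rVmeas set0.
Proof. exact: sigma_algebra0. Qed.

Let rVmeasC (A : set 'rV[R]_n) : rVmeas A -> rVmeas (~` A).
Proof. exact: sigma_algebraC. Qed.

Let rVmeasU (F : (set 'rV[R]_n)^nat) :
  (forall i, rVmeas (F i)) -> rVmeas (\bigcup_i F i).
Proof. exact: sigma_algebra_bigcup. Qed.

HB.instance Definition _ := @isMeasurable.Build rV_display 'rV[R]_n
  rVmeas rVmeas0 rVmeasC rVmeasU.

End rV_measurable.

Definition rVcons (R : realType) (n : nat) (p : measurableTypeR R * 'rV[R]_n) :
  'rV[R]_n.+1 := row_mx (p.1 : R)%:M p.2.

(* n-dimensional Lebesgue measure on the Borel sets, as the n-fold product of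
   the one-dimensional one; see lebn_box. *)
Fixpoint lebn (R : realType) (n : nat) : set 'rV[R]_n -> \bar R :=
  match n with
  | 0 => dirac (0 : 'rV[R]_0)
  | m.+1 => pushforward
      (@lebesgue_measure R \x @lebn R m)%E (@rVcons R m)
  end.
Arguments lebn {R} n.

Lemma measurable_coord (R : realType) (n : nat) (i : 'I_n) :
  measurable_fun [set: 'rV[R]_n] (coord i).
Proof.
move=> _ Y mY; apply: sub_sigma_algebra.
by rewrite -bigcup_seq/=; exists i; [rewrite /= mem_index_enum|exists Y].
Qed.

Lemma measurable_rVP (R : realType) d (T : measurableType d) (n : nat)
    (f : T -> 'rV[R]_n) :
  (forall i, measurable_fun [set: T] (coord i \o f)) ->
  measurable_fun [set: T] f.
Proof.
move=> mf _ A mA; rewrite setTI.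
have : preimage_set_system [set: T] f (g_sigma_preimage (@coord R n))
    (f @^-1` A) by exists A => //; rewrite setTI.
rewrite -g_sigma_preimage_comp; apply: smallest_sub.
  exact: sigma_algebra_measurable.
rewrite -bigcup_seq => B [i _] [Y mY <-].
exact: mf.
Qed.

Lemma rVcons0 (R : realType) (n : nat) p :
  coord ord0 (@rVcons R n p) = p.1.
Proof.
have -> : ord0 = lshift n (ord0 : 'I_1) by exact/val_inj.
rewrite /coord /rVcons; apply: etrans (row_mxEl _ _ _ _) _.
by rewrite mxE eqxx mulr1n.
Qed.

Lemma rVconsS (R : realType) (n : nat) (i : 'I_n) p :
  coord (lift ord0 i) (@rVcons R n p) = coord i p.2.
Proof. have -> : lift ord0 i = rshift 1 i by exact/val_inj.
exact: row_mxEr. Qed.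

Lemma measurable_rVcons (R : realType) (n : nat) :
  measurable_fun [set: measurableTypeR R * 'rV[R]_n] (@rVcons R n).
Proof.
apply: measurable_rVP => i; case: (unliftP ord0 i) => [j|] ->.
  rewrite (_ : _ \o _ = coord j \o snd); last exact/funext/rVconsS.
  exact: measurableT_comp (@measurable_coord _ _ _) measurable_snd.
rewrite (_ : _ \o _ = fst); last exact/funext/rVcons0.
exact: measurable_fst.
Qed.

Lemma measurable_rVtail (R : realType) (n : nat) :
  measurable_fun [set: 'rV[R]_n.+1]
    (fun x : 'rV[R]_n.+1 => (coord ord0 x, rsubmx (x : 'rV[R]_(1 + n)))).
Proof.
apply/measurable_fun_pair; first exact: measurable_coord.
apply: measurable_rVP => i.
rewrite (_ : _ \o _ = coord (lift ord0 i)); first exact: measurable_coord.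
have E : lift ord0 i = rshift 1 i by exact/val_inj.
by apply/funext => x; rewrite /coord/= mxE E.
Qed.

Section lebn_succ.
Context (R : realType) (n : nat).
Variable mu : {sigma_finite_measure set 'rV[R]_n -> \bar R}.

Let nu := pushforward (@lebesgue_measure R \x mu)%E (@rVcons R n).

Let mrVcons := @measurable_rVcons R n.

Let nu0 : nu set0 = 0%E. Proof. exact: measure0. Qed.

Let nu_ge0 A : (0 <= nu A)%E. Proof. exact: measure_ge0. Qed.

Let nu_sigma_additive : semi_sigma_additive nu.
Proof. exact: measure_semi_sigma_additive. Qed.

HB.instance Definition _ := isMeasure.Build _ _ _ nu
  nu0 nu_ge0 nu_sigma_additive.

Let nu_sigma_finite : sigma_finite [set: 'rV[R]_n.+1] nu.
Proof.
pose tl (x : 'rV[R]_n.+1) := (coord ord0 x, rsubmx (x : 'rV[R]_(1 + n))).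
have tlK p : tl (rVcons p) = p.
  rewrite /tl rVcons0 /rVcons; case: p => a y /=; congr (_, _).
  exact: row_mxKr.
have /sigma_finiteP[F [TF ndF Foo]] := sigma_finiteT (@lebesgue_measure R).
have /sigma_finiteP[G [TG ndG Goo]] := sigma_finiteT mu.
exists (fun k => tl @^-1` (F k `*` G k)).
  rewrite -preimage_bigcup predeqE => x; split => // _ /=.
  have [i _ Fix] : (\bigcup_k F k) (tl x).1 by rewrite -TF.
  have [j _ Gjx] : (\bigcup_k G k) (tl x).2 by rewrite -TG.
  exists (maxn i j) => //; split.
  - by move: Fix; exact/subsetPset/ndF/leq_maxl.
  - by move: Gjx; exact/subsetPset/ndG/leq_maxr.
move=> k; have [mF Fk] := Foo k; have [mG Gk] := Goo k; split.
  rewrite -[X in measurable X]setTI; apply: measurable_rVtail => //.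
  exact: measurableX.
rewrite /nu /pushforward -comp_preimage (_ : tl \o _ = id); last exact/funext.
by rewrite preimage_id product_measure1E// lte_mul_pinfty// ge0_fin_numE.
Qed.

HB.instance Definition _ := Measure_isSigmaFinite.Build _ _ _ nu
  nu_sigma_finite.

Definition lebn_step : {sigma_finite_measure set 'rV[R]_n.+1 -> \bar R} := nu.

End lebn_succ.

Lemma lebn_sigma_finite_measure (R : realType) (n : nat) :
  exists mu : {sigma_finite_measure set 'rV[R]_n -> \bar R},
    lebn n = mu :> (set 'rV[R]_n -> \bar R).
Proof.
elim: n => [|n [mu lebnE]]; first by exists (dirac (0 : 'rV[R]_0)).
by exists (lebn_step mu); rewrite /= lebnE.
Qed.

Section lebn_measure.
Context (R : realType) (n : nat).

Let lebn0 : @lebn R n set0 = 0%E.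
Proof. by have [mu ->] := lebn_sigma_finite_measure R n. Qed.

Let lebn_ge0 A : (0 <= @lebn R n A)%E.
Proof. by have [mu ->] := lebn_sigma_finite_measure R n. Qed.

Let lebn_sigma_additive : semi_sigma_additive (@lebn R n).
Proof.
have [mu ->] := lebn_sigma_finite_measure R n.
exact: measure_semi_sigma_additive.
Qed.

HB.instance Definition _ := isMeasure.Build _ _ _ (@lebn R n)
  lebn0 lebn_ge0 lebn_sigma_additive.

Let lebn_sigma_finite : sigma_finite [set: 'rV[R]_n] (@lebn R n).
Proof.
by have [mu ->] := lebn_sigma_finite_measure R n; exact: sigma_finiteT.
Qed.

HB.instance Definition _ := Measure_isSigmaFinite.Build _ _ _ (@lebn R n)
  lebn_sigma_finite.

End lebn_measure.

Lemma lebn_box (R : realType) (n : nat) (A : 'I_n -> set (measurableTypeR R)) :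
  (forall i, measurable (A i)) ->
  lebn n [set x | forall i, A i (coord i x)] =
    (\prod_(i < n) lebesgue_measure (A i))%E.
Proof.
elim: n A => [|n IHn] A mA.
  by rewrite big_ord0 /= diracE mem_set//= => -[].
rewrite big_ord_recl /= -IHn; last by move=> i; exact: mA.
have [mu lebnE] := lebn_sigma_finite_measure R n.
rewrite lebnE /pushforward -product_measure1E//; last first.
  rewrite (_ : [set _ | _] =
      \big[setI/setT]_(i < n) (coord i @^-1` A (lift ord0 i))).
    apply: bigsetI_measurable => i _.
    by rewrite -[X in measurable X]setTI; exact: measurable_coord.
  rewrite -bigcap_seq; apply/seteqP; split => [x xA i _|x xA i]; first exact: xA.
  by apply: xA; rewrite /= mem_index_enum.
congr (_ _); apply/seteqP; split => -[a y] /=.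
  move=> ayA; split; first by have := ayA ord0; rewrite rVcons0.
  by move=> i; have := ayA (lift ord0 i); rewrite rVconsS.
move=> [aA yA] i; case: (unliftP ord0 i) => [j|] ->.
  by rewrite rVconsS; exact: yA.
by rewrite rVcons0.
Qed.

(* completed_algebra_gen (lebn n) consists of the Lebesgue measurable sets
   (Borel sets up to a negligible set), so that f need not be Borel.  The
   integral of such a function against lebn n is still its Lebesgue integral:
   the library's integral is a supremum over Borel simple functions, which is
   insensitive to negligible sets. *)
Definition lebesgue_measurable_fun (R : realType) (n : nat)
    (D : set 'rV[R]_n) (f : 'rV[R]_n -> R) : Prop :=
  forall Y : set R, measurable Y ->
    completed_algebra_gen (@lebn R n) (D `&` f @^-1` Y).

Section PDE.
Context {R : realType} {n : nat}.
Implicit Types (u V phi : 'rV[R]_n -> R) (x : 'rV[R]_n) (eps : R).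

(* Euclidean norm; `|x| would be the sup norm. *)
Definition enorm x : R := Num.sqrt (\sum_(i < n) x ord0 i ^+ 2).

Definition unit_ball : set 'rV[R]_n := [set x | enorm x < 1].
Definition closed_unit_ball : set 'rV[R]_n := [set x | enorm x <= 1].
Definition unit_sphere : set 'rV[R]_n := [set x | enorm x = 1].

Definition partial (i : 'I_n) (f : 'rV[R]_n -> R) : 'rV[R]_n -> R :=
  fun x => 'D_(delta_mx ord0 i) f x.

(* C^1 up to the boundary: u is continuous on the closed ball and its partial
   derivatives, which exist in the open ball, extend continuously to the closed
   ball.  The values of u outside the closed ball play no role. *)
Definition C1_closed_ball u : Prop :=
  {within closed_unit_ball, continuous u} /\
  forall i : 'I_n, exists g : 'rV[R]_n -> R,
    {within closed_unit_ball, continuous g} /\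
    forall x, unit_ball x ->
      derivable u x (delta_mx ord0 i) /\ partial i u x = g x.

Definition iter_partial (s : seq 'I_n) (f : 'rV[R]_n -> R) : 'rV[R]_n -> R :=
  foldr partial f s.

Definition smooth (f : 'rV[R]_n -> R) : Prop :=
  forall s : seq 'I_n, continuous (iter_partial s f) /\
    forall (i : 'I_n) x, derivable (iter_partial s f) x (delta_mx ord0 i).

(* C_0^oo(B), each function being extended by 0 to R^n. *)
Definition test_function phi : Prop :=
  [/\ smooth phi, compact (closure [set x | phi x != 0]) &
      closure [set x | phi x != 0] `<=` unit_ball].

Definition critical_exponent : R := (2 * n%:R) / (n%:R - 2).

Definition weak_solution eps V u : Prop :=
  forall phi, test_function phi ->
    (\int[lebn n]_(x in unit_ball)
        (\sum_(i < n) partial i u x * partial i phi x)%:E =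
     \int[lebn n]_(x in unit_ball)
        (V x * u x `^ (critical_exponent - 1 - eps) * phi x)%:E)%E.

Definition is_solution eps V u : Prop :=
  [/\ C1_closed_ball u,
      weak_solution eps V u,
      forall x, unit_ball x -> 0 < u x &
      forall x, unit_sphere x -> u x = 0].

End PDE.

Arguments critical_exponent R n : clear implicits.

(* Main.v *)
Require Import Defs.
From HB Require Import structures.
From mathcomp Require Import all_boot all_order all_algebra.
From mathcomp Require Import all_classical all_reals all_analysis.
From mathcomp Require Import measurable_realfun ring lra.

Import Order.TTheory GRing.Theory Num.Theory.
Import numFieldNormedType.Exports.

Local Open Scope classical_set_scope.
Local Open Scope ring_scope.

(** For a radial kernel k, the dilation mean U(r) = int u(y + r z) k(z) dz has
    derivative -(2 r^(n-1))^-1 times the weak Laplacian of u tested against a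
    smooth cutoff rescaled to radius r about y.  Hence, if 0 <= Delta u <= A, U is
    nonincreasing and u(y) int k <= U(s) + A c s^2 / 2.

    Let M = sup u = u(x0) and A = b M^p, p = N - 1 - eps.  Comparison with a
    paraboloid gives u <= C A (1 - |x|^2).  At x0 this bounds M from below, as
    p - 1 >= 2 / (n - 2), and bounds the distance of x0 to the sphere from below
    by a multiple of M / A.  Hence the mean of u over the ball of radius about
    M / A around x0 is at least a multiple of M.  Comparing the dilation means at
    the origin for the radii 1 and 1 - O(M / A), with a kernel whose support
    reaches beyond x0, transports this to the mean over a fixed central ball with
    a loss of only (M / A)^(n-1), and a chain of balls carries it to K.  So
    inf_K u >= c M (M / A)^(n-1), and M^7 inf_K u >= c' M^(8 - (n-1)(p-1)), whose
    exponent is nonnegative because p - 1 <= 4 / (n - 2) and n >= 3. *)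

(** * Euclidean norm and Borel sets *)

(** The exponent 7 is decided by n = 3 and eps = 0: there (n-1)(p-1) = 8, and one factor M is
    already present in the lower bound on K. Covering the ball about x0 by a single kernel centred
    at the origin would lose (M/A)^n, and n(p-1) reaches 12. Taking the difference of two dilation
    means recovers one power, because what it costs is 1 - r^n, which is itself of the order of the
    radius of that ball.

    As V is merely measurable and u only C^1, no second derivative and no representation formula is
    used. The kernel is built so that z k(z) is -1/2 times the gradient of a smooth compactly
    supported function: differentiating u(y + r z) in r produces z . grad u, and integrating this
    against k is exactly the weak form of the equation. The comparisons also need k to be
    nonincreasing in |z|, which restricts the choice of the profile. *)

Section euclidean.
Context {R : realType} {n : nat}.
Implicit Types x y z : 'rV[R]_n.

Definition sqnorm x : R := \sum_(i < n) x ord0 i ^+ 2.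

Lemma sqnorm_ge0 x : 0 <= sqnorm x.
Proof. by apply: sumr_ge0 => i _; exact: sqr_ge0. Qed.

Lemma sqr_enorm x : enorm x ^+ 2 = sqnorm x.
Proof. by rewrite sqr_sqrtr// sqnorm_ge0. Qed.

Lemma enorm_ge0 x : 0 <= enorm x. Proof. exact: sqrtr_ge0. Qed.

Lemma enorm_le_sqnorm x (c : R) : 0 <= c -> (enorm x <= c) = (sqnorm x <= c ^+ 2).
Proof. by move=> c0; rewrite -sqr_enorm ler_pXn2r// nnegrE enorm_ge0. Qed.

Lemma enorm_lt_sqnorm x (c : R) : 0 <= c -> (enorm x < c) = (sqnorm x < c ^+ 2).
Proof. by move=> c0; rewrite -sqr_enorm ltr_pXn2r// nnegrE enorm_ge0. Qed.

Lemma sqnormZ (a : R) x : sqnorm (a *: x) = a ^+ 2 * sqnorm x.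
Proof. by rewrite /sqnorm mulr_sumr; apply: eq_bigr => i _; rewrite mxE exprMn. Qed.

Lemma sqnormN x : sqnorm (- x) = sqnorm x.
Proof. by rewrite -scaleN1r sqnormZ sqrrN expr1n mul1r. Qed.

Lemma enormZ (a : R) x : enorm (a *: x) = `|a| * enorm x.
Proof.
rewrite /enorm -/(sqnorm _) sqnormZ sqrtrM ?sqr_ge0// sqrtr_sqr.
by [].
Qed.

Lemma enormN x : enorm (- x) = enorm x.
Proof. by rewrite -scaleN1r enormZ normrN1 mul1r. Qed.

Lemma sqnorm0 : sqnorm (0 : 'rV[R]_n) = 0.
Proof. by rewrite /sqnorm big1// => i _; rewrite mxE expr0n. Qed.

Lemma enorm0 : enorm (0 : 'rV[R]_n) = 0.
Proof. by rewrite /enorm -/(sqnorm _) sqnorm0 sqrtr0. Qed.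

Lemma sqnormD x y :
  sqnorm (x + y) = sqnorm x + 2 * (\sum_(i < n) x ord0 i * y ord0 i) + sqnorm y.
Proof.
rewrite /sqnorm mulr_sumr -!big_split/=; apply: eq_bigr => i _.
by rewrite mxE; ring.
Qed.

Lemma ler_coord_enorm x i : `|x ord0 i| <= enorm x.
Proof.
rewrite -sqrtr_sqr ler_sqrt ?sqnorm_ge0// (bigD1 i)//= lerDl.
by apply: sumr_ge0 => j _; exact: sqr_ge0.
Qed.

(** Cauchy-Schwarz: expand |q x - p y|^2 >= 0, with p and q the two norms, and cancel p q; if p q =
    0, one of the vectors vanishes. *)
Lemma sum_le_enorm x y : \sum_(i < n) x ord0 i * y ord0 i <= enorm x * enorm y.
Proof.
set p := enorm x; set q := enorm y.
have p0 : 0 <= p := enorm_ge0 x.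
have q0 : 0 <= q := enorm_ge0 y.
have [pq0|] := ltP 0 (p * q).
  have := sqnorm_ge0 (q *: x + (- p) *: y).
  rewrite sqnormD !sqnormZ -!sqr_enorm -/p -/q.
  under eq_bigr do rewrite !mxE mulrACA.
  rewrite -mulr_sumr; set S := \sum_(_ < _) _ => H.
  rewrite -(ler_pM2l pq0); nra.
have coord0 z i : enorm z = 0 -> z ord0 i = 0.
  by move=> z0; apply/eqP; rewrite -normr_le0 -z0 ler_coord_enorm.
rewrite le_eqVlt ltNge mulr_ge0// orbF mulf_eq0 => /orP[]/eqP z0.
  by rewrite big1 ?z0 ?mul0r// => i _; rewrite coord0// mul0r.
by rewrite big1 ?z0 ?mulr0// => i _; rewrite [y _ _]coord0// mulr0.
Qed.

Lemma normr_sum_le_enorm x y :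
  `|\sum_(i < n) x ord0 i * y ord0 i| <= enorm x * enorm y.
Proof.
rewrite ler_norml sum_le_enorm andbT lerNl -sumrN -(enormN x).
by rewrite (le_trans _ (sum_le_enorm (- x) y))// ler_sum// => i _; rewrite mxE mulNr.
Qed.

Lemma enormD x y : enorm (x + y) <= enorm x + enorm y.
Proof.
rewrite enorm_le_sqnorm ?addr_ge0 ?enorm_ge0// sqnormD sqrrD !sqr_enorm.
by have := sum_le_enorm x y; lra.
Qed.

Lemma enormB x y : enorm (x - y) <= enorm x + enorm y.
Proof. by rewrite (le_trans (enormD _ _))// enormN. Qed.

Lemma ler_norm_enorm x : `|x| <= enorm x.
Proof.
rewrite [leLHS]/Num.norm/= mx_normrE; apply: bigmax_le; first exact: enorm_ge0.
by move=> [i j] _ /=; rewrite (ord1 i); exact: ler_coord_enorm.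
Qed.

Lemma continuous_sqnorm : continuous (sqnorm : 'rV[R]_n -> R).
Proof.
apply: continuous_big => [|i _ x]; first exact: add_continuous.
apply: (@continuous_comp _ _ _ (fun y : 'rV[R]_n => y ord0 i) (@GRing.exp R ^~ 2%N)).
  exact: coord_continuous.
exact: exprn_continuous.
Qed.

Lemma continuous_enorm : continuous (enorm : 'rV[R]_n -> R).
Proof.
by move=> x; apply: (continuous_comp (continuous_sqnorm x)); exact: sqrt_continuous.
Qed.

Lemma open_unit_ball : open (@unit_ball R n).
Proof.
rewrite (_ : unit_ball = enorm @^-1` [set t | t < 1])//.
by apply: open_comp => [x _|]; [exact: continuous_enorm|exact: open_lt].
Qed.

Lemma compact_closed_ball (r : R) : compact [set x : 'rV[R]_n | enorm x <= r].
Proof.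
apply: bounded_closed_compact.
  exists r; split; first exact: num_real.
  by move=> M rM x /= xr; rewrite (le_trans (ler_norm_enorm x))// (le_trans xr)// ltW.
rewrite (_ : [set _ | _] = enorm @^-1` [set t | t <= r])//.
by apply: (continuous_closedP _).1; [exact: continuous_enorm|exact: closed_le].
Qed.

End euclidean.

Section borel.
Context {R : realType} {n : nat}.

Let box (p : 'rV[rat]_n * nat) : set 'rV[R]_n :=
  [set x | forall i, `|x ord0 i - ratr (p.1 ord0 i)| < p.2.+1%:R^-1].

(** An open set is the union of the countably many rational cubes that it contains. This ties the
    product sigma-algebra to the sup-norm topology. *)
Lemma open_measurable_rV (A : set 'rV[R]_n) : open A -> measurable A.
Proof.
move=> oA; pose P := [set p | box p `<=` A].
have -> : A = \bigcup_(p in P) box p.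
  apply/seteqP; split => [x Ax|x [p]]; last exact.
  have /nbhs_ballP[e /= e0 eA] : nbhs x A by exact: open_nbhs_nbhs.
  have [m me] : exists m : nat, m.+1%:R^-1 < e / 2.
    by exists `|Num.trunc ((e / 2)^-1)|%N; rewrite invf_plt ?posrE ?divr_gt0// truncnS_gt.
  have hq i : exists q : rat, `|x ord0 i - ratr q| < m.+1%:R^-1.
    have [t [xq [q _ qt]]] : ball (x ord0 i) m.+1%:R^-1 `&` (@ratr R @` setT) !=set0.
      apply: dense_rat; last exact: ball_open.
      by exists (x ord0 i); apply: ballxx; rewrite invr_gt0.
    by exists q; rewrite qt.
  exists (\row_i sval (cid (hq i)), m); last first.
    by move=> i; rewrite /= mxE; case: cid.
  move=> y yb; apply: eA; rewrite /ball/= /mx_ball; split => // i j.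
  rewrite (ord1 i) /ball/=; have := yb j; rewrite /= mxE; case: cid => q /= xq yq.
  rewrite (splitr e) (le_lt_trans (ler_distD (ratr q) _ _))// ltrD//.
    exact: lt_trans xq me.
  by rewrite distrC; exact: lt_trans yq me.
rewrite bigcup_mkcond; apply: countable_bigcupT_measurable => [|p]; first exact: countableP.
case: ifPn => // _.
have -> : box p = \bigcap_(i in [set: 'I_n])
    (Defs.coord i @^-1` (ball (ratr (p.1 ord0 i) : R) (p.2.+1%:R^-1 : R) : set R)).
  apply/seteqP; split => [x xb i _|x xb i].
    by rewrite /ball/= distrC; exact: xb.
  by rewrite distrC; exact: (xb i I).
apply: fin_bigcap_measurable => // i _.
rewrite -[X in measurable X]setTI; apply: measurable_coord => //.
exact: measurable_ball.
Qed.

Lemma open_continuous_measurable_rV (D : set 'rV[R]_n) (f : 'rV[R]_n -> R) :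
  open D -> {in D, continuous f} -> measurable_fun D f.
Proof.
move=> oD cf mD; apply: (measurability _ (RGenOpens.measurableE R)) => //.
move=> _ [_ [a [b ->] <-]]; apply: open_measurable_rV.
rewrite openE => x [Dx fx]; rewrite /interior.
have nD : nbhs x D by exact: open_nbhs_nbhs.
apply: filterI => //; apply: (cf x); first by rewrite inE.
by apply: open_nbhs_nbhs; split => //; exact: interval_open.
Qed.

Lemma continuous_measurable_rV (f : 'rV[R]_n -> R) :
  continuous f -> measurable_fun setT f.
Proof. by move=> cf; apply: open_continuous_measurable_rV => //; exact: openT. Qed.

End borel.

(** * Lebesgue measure under affine maps *)

(** Packages a scaled image measure as a measure structure, the form to which the uniqueness
    theorems for Lebesgue and product measures apply. *)
Lemma ex_scaled_pushforward {d d'} {T : measurableType d} {T' : measurableType d'}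
    {R : realType} (m : {measure set T -> \bar R}) (f : T -> T') (c : R) :
  measurable_fun [set: T] f -> 0 <= c ->
  exists m' : {measure set T' -> \bar R}, forall A, m' A = (c%:E * m (f @^-1` A))%E.
Proof.
move=> mf c0.
exists (mscale (NngNum c0)
  (measure_function_pushforward__canonical__measure_function_Measure m mf)).
by [].
Qed.

Section affine.
Context {R : realType}.

Lemma measurable_affine (y r : R) :
  measurable_fun setT (fun a : measurableTypeR R => y + r * a : measurableTypeR R).
Proof.
apply: continuous_measurable_fun => x.
by apply: cvgD; [exact: cvg_cst|apply: cvgM; [exact: cvg_cst|exact: cvg_id]].
Qed.

(** Both sides are measures that agree on half-open intervals; for r < 0 the preimage is half-open
    at the other end, with the same length. Negative r serves later for the reflection in
    [dot_kern0]. *)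
Lemma lebesgue_measure_affine (y r : R) (A : set (measurableTypeR R)) :
  r != 0 -> measurable A ->
  lebesgue_measure A =
    (`|r|%:E * lebesgue_measure ((fun a : R => (y + r * a)%R) @^-1` A))%E.
Proof.
move=> r0 mA.
have [m mE] := ex_scaled_pushforward (@lebesgue_measure R) _ _
  (measurable_affine y r) (normr_ge0 r).
rewrite -mE; apply: lebesgue_measure_unique => // _ [[a b]] /= ab <-.
rewrite mE lebesgue_measure_itv/= lte_fin.
have [r1|r1] := ltP 0 r.
  have -> : (fun a : R => y + r * a) @^-1` `]a, b] = [set` `](a - y) / r, (b - y) / r]].
    apply/seteqP; split => z /=; rewrite !in_itv/=.
      by rewrite ltr_pdivrMr// ler_pdivlMr// => /andP[? ?]; apply/andP; split; lra.
    by rewrite ltr_pdivrMr// ler_pdivlMr// => /andP[? ?]; apply/andP; split; lra.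
  rewrite lebesgue_measure_itv/= lte_fin ltr_pM2r ?invr_gt0// ltrD2r.
  case: ifPn => _; last by rewrite mule0.
  rewrite -!EFinB -EFinM; congr EFin; rewrite gtr0_norm//.
  by field.
have {}r1 : r < 0 by rewrite lt_neqAle r0.
have -> : (fun a : R => y + r * a) @^-1` `]a, b] = [set` `[(b - y) / r, (a - y) / r[].
  apply/seteqP; split => z /=; rewrite !in_itv/=.
    by rewrite ler_ndivrMr// ltr_ndivlMr// => /andP[? ?]; apply/andP; split; lra.
  by rewrite ler_ndivrMr// ltr_ndivlMr// => /andP[? ?]; apply/andP; split; lra.
rewrite lebesgue_measure_itv/= lte_fin ltr_nM2r ?invr_lt0// ltrD2r.
case: ifPn => _; last by rewrite mule0.
rewrite -!EFinB -EFinM; congr EFin; rewrite ltr0_norm//.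
by field.
Qed.

Lemma measurable_affine_rV {n} (y : 'rV[R]_n) (r : R) :
  measurable_fun setT (fun z : 'rV[R]_n => y + r *: z).
Proof.
apply: measurable_rVP => i.
rewrite (_ : _ \o _ = (fun a : measurableTypeR R => Defs.coord i y + r * a) \o Defs.coord i).
  by apply: measurableT_comp; [exact: measurable_affine|exact: measurable_coord].
by apply/funext => z; rewrite /Defs.coord /= !mxE.
Qed.

Lemma lebn_affine {n} (y : 'rV[R]_n) (r : R) (A : set 'rV[R]_n) :
  r != 0 -> measurable A ->
  lebn n A = ((`|r| ^+ n)%:E * lebn n ((fun z => (y + r *: z)%R) @^-1` A))%E.
Proof.
move=> r0; elim: n y A => [|n IH] y A mA.
  rewrite expr0 mul1e /= !diracE; congr (_%:R%:E); congr nat_of_bool.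
  by apply/idP/idP; rewrite !inE/=; rewrite (_ : y + r *: 0 = 0)//; apply/rowP => -[].
pose y0 : R := Defs.coord ord0 y; pose y' : 'rV[R]_n := rsubmx (y : 'rV[R]_(1 + n)).
pose Phi (p : measurableTypeR R * 'rV[R]_n) : measurableTypeR R * 'rV[R]_n :=
  (y0 + r * p.1, y' + r *: p.2).
have mPhi : measurable_fun setT Phi.
  apply/measurable_fun_pair.
    exact: (measurableT_comp (measurable_affine y0 r) measurable_fst).
  exact: (measurableT_comp (measurable_affine_rV y' r) measurable_snd).
have PhiE p : rVcons (Phi p) = y + r *: rVcons p.
  apply/rowP => i; rewrite [RHS]mxE [X in _ = _ + X]mxE.
  rewrite -!/(Defs.coord i _); case: (unliftP ord0 i) => [j|] ->.
    rewrite !rVconsS /Phi/= /Defs.coord !mxE; congr (y _ _ + _).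
    exact/val_inj.
  by rewrite !rVcons0.
have [m mE] := ex_scaled_pushforward (@lebesgue_measure R \x @lebn R n)%E _ _ mPhi
  (exprn_ge0 n.+1 (normr_ge0 r)).
have mB : measurable (@rVcons R n @^-1` A).
  by rewrite -[X in measurable X]setTI; exact: measurable_rVcons.
transitivity (m (@rVcons R n @^-1` A)); last first.
  rewrite mE /= /pushforward; congr (_ * _)%E; congr (_ _).
  by apply/seteqP; split => p /=; rewrite PhiE.
rewrite /= /pushforward; apply: product_measure_unique => // A1 A2 mA1 mA2.
rewrite mE.
have -> : Phi @^-1` (A1 `*` A2) = ((fun a : R => y0 + r * a) @^-1` A1) `*`
    ((fun z => y' + r *: z) @^-1` A2) by [].
have mA1' : measurable ((fun a : measurableTypeR R => y0 + r * a : measurableTypeR R) @^-1` A1).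
  by rewrite -[X in measurable X]setTI; exact: measurable_affine.
have mA2' : measurable ((fun z : 'rV[R]_n => y' + r *: z) @^-1` A2).
  by rewrite -[X in measurable X]setTI; exact: measurable_affine_rV.
transitivity ((`|r| ^+ n.+1)%:E *
    (lebesgue_measure ((fun a : R => (y0 + r * a)%R) @^-1` A1) *
     lebn n ((fun z => (y' + r *: z)%R) @^-1` A2)))%E.
  by congr (_ * _)%E; exact: (product_measure1E (@lebesgue_measure R) (lebn n)).
transitivity (lebesgue_measure A1 * lebn n A2)%E => //.
rewrite (lebesgue_measure_affine y0 _ _ r0 mA1) (IH y' _ mA2).
by rewrite exprS EFinM muleACA.
Qed.

Lemma ge0_integral_affine {n} (y : 'rV[R]_n) (r : R) (F : 'rV[R]_n -> \bar R) :
  r != 0 -> measurable_fun setT F -> (forall x, (0 <= F x)%E) ->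
  (\int[lebn n]_x F x = (`|r| ^+ n)%:E * \int[lebn n]_z F (y + r *: z)%R)%E.
Proof.
move=> r0 mF F0.
have rn0 : 0 <= `|r| ^+ n by rewrite exprn_ge0.
pose m' := measure_function_pushforward__canonical__measure_function_Measure
  (lebn n) (measurable_affine_rV y r).
transitivity (\int[mscale (NngNum rn0) m']_x F x)%E.
  apply: eq_measure_integral => A mA _.
  exact: lebn_affine.
by rewrite ge0_integral_mscale// ge0_integral_pushforward//; exact: measurable_affine_rV.
Qed.

End affine.

(** * A smooth radial cutoff *)

Section derive_lambda.
Context {R : realType} {V : normedModType R}.
Implicit Types (f g : V -> R) (x v : V) (a b : R).

Lemma is_deriveD_fun f g x v a b : is_derive x v f a -> is_derive x v g b ->
  is_derive x v (fun y => f y + g y) (a + b).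
Proof. exact: is_deriveD. Qed.

Lemma is_deriveM_fun f g x v a b : is_derive x v f a -> is_derive x v g b ->
  is_derive x v (fun y => f y * g y) (f x * b + g x * a).
Proof. exact: is_deriveM. Qed.

Lemma is_derive1_comp_fun (h k : R -> R) (x a b : R) :
  is_derive (k x) 1 h a -> is_derive x 1 k b ->
  is_derive x 1 (fun y => h (k y)) (a * b).
Proof. exact: is_derive1_comp. Qed.

Lemma is_derive_line f x v a :
  is_derive (0 : R) 1 (fun t : R => f (t *: v + x)) a <-> is_derive x v f a.
Proof.
have E : (fun h : R => h^-1 *: (((fun t : R => f (t *: v + x)) \o shift 0) (h *: 1)
      - f (0 *: v + x))) = (fun h : R => h^-1 *: ((f \o shift x) (h *: v) - f x)).
  by apply/funext => h; rewrite /= addr0 scale0r add0r /GRing.scale/= mulr1.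
by split=> -[df dfE]; split; move: df dfE; rewrite /derivable /derive E.
Qed.

Lemma is_derive_comp_real (h : R -> R) f x v a b :
  is_derive (f x) 1 h a -> is_derive x v f b ->
  is_derive x v (fun y => h (f y)) (a * b).
Proof.
move=> dh /is_derive_line df; apply/is_derive_line.
by apply: (is_derive1_comp_fun h) => //; rewrite scale0r add0r.
Qed.

End derive_lambda.

Section expinv.
Context {R : realType}.
Implicit Types (x y : R) (j : nat).

(** The functions x^-j exp(-1/x), extended by 0, have derivatives that are linear combinations of
    the same family, so one derivative formula yields smoothness of all orders. *)
Definition expinv j x : R := if 0 < x then x^-1 ^+ j * expR (- x^-1) else 0.

Lemma expinv_pos j x : 0 < x -> expinv j x = x^-1 ^+ j * expR (- x^-1).
Proof. by rewrite /expinv => ->. Qed.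

Lemma expinv_npos j x : x <= 0 -> expinv j x = 0.
Proof. by rewrite /expinv leNgt => /negPf ->. Qed.

Lemma expinv_ge0 j x : 0 <= expinv j x.
Proof.
rewrite /expinv; case: ifPn => // x0.
by rewrite mulr_ge0 ?expR_ge0// exprn_ge0// invr_ge0 ltW.
Qed.

Lemma expinvS j x : expinv j x = x * expinv j.+1 x.
Proof.
have [x0|x0] := ltP 0 x; last by rewrite !expinv_npos// mulr0.
by rewrite !expinv_pos// exprS; field; rewrite gt_eqF.
Qed.

(** With t = 1/x this is t^j <= j! exp t, a single term of the exponential series. *)
Lemma expinv_le_fact j x : expinv j x <= j`!%:R.
Proof.
have [x0|x0] := ltP 0 x; last by rewrite expinv_npos.
rewrite expinv_pos// expRN ler_pdivrMr ?expR_gt0//.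
have t0 : 0 <= x^-1 by rewrite invr_ge0 ltW.
case: j => [|j]; first by rewrite expr0 mul1r -expR0 ler_expR.
have := expR_ge1Dxn j t0 => H.
rewrite -ler_pdivrMl ?ltr0n ?fact_gt0// mulrC.
by rewrite (le_trans _ H)// lerDr.
Qed.

Lemma is_derive_expinv j x :
  is_derive x 1 (expinv j) (expinv j.+2 x - j%:R * expinv j.+1 x).
Proof.
have [x0|x0|<-] := ltgtP 0 x.
- have E : \near x, (fun y => y^-1 ^+ j * expR (- y^-1)) x = expinv j x.
    by near=> t; rewrite expinv_pos//; near: t; exact: lt_nbhsr.
  apply: (near_eq_is_derive E) => {E}.
  have dV : is_derive x 1 (fun y => y^-1) (- x ^- 2).
    apply: is_derive_eq; first by apply: (is_deriveV (f := id)); rewrite gt_eqF.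
    by rewrite /= /GRing.scale/= mulr1.
  have dE : is_derive x 1 (fun y => expR (- y^-1)) (expR (- x^-1) * x ^- 2).
    have := is_derive1_comp_fun expR (fun y : R => - y^-1) x _ _ (is_derive_expR _) (is_deriveN dV).
    by rewrite opprK.
  have dP : is_derive x 1 (fun y : R => y^-1 ^+ j) (j%:R * x^-1 ^+ j.-1 * - x ^- 2).
    rewrite (_ : (fun y : R => y^-1 ^+ j) = (fun y : R => y^-1) ^+ j); first exact: is_deriveX.
    by apply/funext => y; rewrite exprfctE.
  apply: is_derive_eq (is_deriveM_fun _ _ _ _ _ _ dP dE) _.
  rewrite !expinv_pos//.
  case: j {dP} => [|j]; first by rewrite expr0 !mul0r mulr0 addr0 subr0; field; rewrite gt_eqF.
  by rewrite /= !exprS; field; rewrite gt_eqF.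
- have E : \near x, (cst 0 : R -> R) x = expinv j x.
    by near=> t; rewrite expinv_npos//; rewrite ltW//; near: t; exact: lt_nbhsl.
  apply: (near_eq_is_derive E).
  apply: is_derive_eq (is_derive_cst (0 : R) x 1) _.
  by rewrite !expinv_npos ?(ltW x0)// mulr0 subr0.
(* At 0 the difference quotient is [expinv j.+1] itself, which tends to 0 because it is x times the
   bounded [expinv j.+2]. *)
- apply/is_derive1_caratheodory; exists (expinv j.+1); split.
  + by move=> z; rewrite expinvS (@expinv_npos j 0)// !subr0 mulrC.
  + apply/cvgrPdist_lt => e e0; rewrite (@expinv_npos _ 0)//.
    near=> t; rewrite sub0r normrN ger0_norm ?expinv_ge0// expinvS.
    have [t0|t0] := ltP 0 t; last by rewrite expinv_npos// mulr0.
    rewrite (le_lt_trans (ler_wpM2l (ltW t0) (expinv_le_fact _ _)))//.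
    rewrite -ltr_pdivlMr ?ltr0n ?fact_gt0//.
    by near: t; apply: lt_nbhsl; rewrite divr_gt0// ltr0n fact_gt0.
  + by rewrite !expinv_npos// mulr0 subr0.
Unshelve. all: by end_near. Qed.

Lemma continuous_expinv j : continuous (expinv j).
Proof.
move=> x; apply: differentiable_continuous; apply/derivable1_diffP.
by apply: ex_derive; exact: is_derive_expinv.
Qed.

End expinv.

Section elementary.
Context {R : realType} {n : nat}.

(* A class of functions closed under partial derivatives. *)
Inductive elementary : ('rV[R]_n -> R) -> Prop :=
| elementary_cst c : elementary (fun=> c)
| elementary_coord i : elementary (fun x => x ord0 i)
| elementaryD f g : elementary f -> elementary g -> elementary (fun x => f x + g x)
| elementaryM f g : elementary f -> elementary g -> elementary (fun x => f x * g x)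
| elementary_expinv j f : elementary f -> elementary (fun x => expinv j (f x)).

Lemma elementary_sum (I : Type) (s : seq I) (F : I -> 'rV[R]_n -> R) :
  (forall i, elementary (F i)) -> elementary (fun x => \sum_(i <- s) F i x).
Proof.
move=> eF; elim: s => [|i s IH].
  by under eq_fun do rewrite big_nil; exact: elementary_cst.
by under eq_fun do rewrite big_cons; exact: elementaryD.
Qed.

Lemma is_derive_coord (x : 'rV[R]_n) (i j : 'I_n) :
  is_derive x (delta_mx ord0 i : 'rV[R]_n) (fun y => y ord0 j) (j == i)%:R.
Proof.
apply/is_derive_line.
rewrite (_ : (fun _ => _) = (fun t : R => t * (j == i)%:R + x ord0 j)); last first.
  by apply/funext => t; rewrite !mxE eqxx.
have did : is_derive (0 : R) (1 : R) (fun t : R => t) 1 by exact: is_derive_id.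
have dc (a : R) : is_derive (0 : R) (1 : R) (fun=> a) 0 by exact: is_derive_cst.
have := is_deriveD_fun _ _ _ _ _ _
  (is_deriveM_fun _ _ _ _ _ _ did (dc (j == i)%:R)) (dc (x ord0 j)).
by rewrite mul0r add0r addr0 mulr1.
Qed.

Lemma elementary_is_derive f : elementary f -> forall i, exists2 f', elementary f' &
  forall x, is_derive x (delta_mx ord0 i : 'rV[R]_n) f (f' x).
Proof.
elim=> [c|j|{}f g ef IHf eg IHg|{}f g ef IHf eg IHg|j {}f ef IHf] i.
- by exists (fun=> 0) => [|x]; [exact: elementary_cst|exact: is_derive_cst].
- exists (fun=> (j == i)%:R) => [|x]; first exact: elementary_cst.
  exact: is_derive_coord.
- have [f' ef' df] := IHf i; have [g' eg' dg] := IHg i.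
  exists (fun x => f' x + g' x) => [|x]; first exact: elementaryD.
  exact: is_deriveD_fun.
- have [f' ef' df] := IHf i; have [g' eg' dg] := IHg i.
  exists (fun x => f x * g' x + g x * f' x) => [|x].
    by apply: elementaryD; exact: elementaryM.
  exact: is_deriveM_fun.
- have [f' ef' df] := IHf i.
  exists (fun x => (expinv j.+2 (f x) + (- j%:R) * expinv j.+1 (f x)) * f' x) => [|x].
    apply: elementaryM => //; apply: elementaryD; first exact: elementary_expinv.
    by apply: elementaryM; [exact: elementary_cst|exact: elementary_expinv].
  by apply: is_derive_comp_real => //; rewrite mulNr; exact: is_derive_expinv.
Qed.

Lemma elementary_continuous f : elementary f -> continuous f.
Proof.
elim=> [c x|j x|{}f g _ cf _ cg x|{}f g _ cf _ cg x|j {}f _ cf x].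
- exact: cst_continuous.
- exact: coord_continuous.
- exact: (continuousD (cf x) (cg x)).
- exact: (continuousM (cf x) (cg x)).
- by apply: (@continuous_comp _ _ _ f (expinv j)); [exact: cf|exact: continuous_expinv].
Qed.

Lemma elementary_iter_partial s f : elementary f -> elementary (iter_partial s f).
Proof.
move=> ef; elim: s => //= i s IH.
have [f' ef' df] := elementary_is_derive _ IH i.
by rewrite (_ : partial i _ = f')//; apply/funext => x; rewrite /partial derive_val.
Qed.

Lemma elementary_smooth f : elementary f -> smooth f.
Proof.
move=> ef s; have es := elementary_iter_partial s _ ef.
split=> [|i x]; first exact: elementary_continuous.
by have [f' _ df] := elementary_is_derive _ es i; exact: ex_derive.
Qed.

End elementary.

Section profile.
Context {R : realType}.
Implicit Types (t : R).

(** The derivative of X exp(-1/X). The factor X is there for monotonicity: the derivative of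
    exp(-1/X) alone, X^-2 exp(-1/X), decreases for X > 1/2. *)
Definition kprof t : R := expinv 0 t + expinv 1 t.

Lemma is_derive_kprof t : is_derive t 1 kprof (expinv 3 t).
Proof.
apply: is_derive_eq (is_deriveD_fun _ _ _ _ _ _ (is_derive_expinv 0 t) (is_derive_expinv 1 t)) _.
by ring.
Qed.

Lemma kprof_nondecreasing t t' : t <= t' -> kprof t <= kprof t'.
Proof.
move=> tt; have [|c _ cE] := MVT_segment tt (fun s _ => is_derive_kprof s).
  by apply: continuous_subspaceT => s; apply: cvgD; exact: continuous_expinv.
by rewrite -subr_ge0 cE mulr_ge0 ?expinv_ge0 ?subr_ge0.
Qed.

Lemma kprof_gt0 t : 0 < t -> 0 < kprof t.
Proof.
move=> t0; rewrite /kprof ltr_pwDl ?expinv_ge0// expinv_pos// expr0 mul1r.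
exact: expR_gt0.
Qed.

Lemma expinv3_ge t : 4^-1 <= t -> t <= 3 / 2 -> expR (- 4) * (2 / 3) ^+ 3 <= expinv 3 t.
Proof.
move=> t4 t32; have t0 : 0 < t by lra.
rewrite expinv_pos// mulrC ler_pM ?expR_ge0//.
- rewrite ler_pXn2r ?nnegrE ?divr_ge0 ?invr_ge0 ?(ltW t0)//.
  by rewrite -[2 / 3]invf_div lef_pV2 ?posrE//; lra.
- rewrite ler_expR lerN2 -[leRHS]invrK lef_pV2 ?posrE//.
Qed.

(** Mean value theorem on [t - 1/4, t], which lies in [1/4, 3/2], where [expinv3_ge] bounds the
    derivative below; monotonicity covers smaller t'. It quantifies the gain in
    [ball_mean_ge_shell]. *)
Lemma kprof_gap t t' : 2^-1 <= t -> t <= 3 / 2 -> t' <= t - 4^-1 ->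
  expR (- 4) * (2 / 3) ^+ 3 / 4 <= kprof t - kprof t'.
Proof.
move=> t2 t32 tt'.
have tt : t - 4^-1 <= t by lra.
have [|c + cE] := MVT_segment tt (fun s _ => is_derive_kprof s).
  by apply: continuous_subspaceT => s; apply: cvgD; exact: continuous_expinv.
rewrite in_itv/= => /andP[c1 c2].
have := kprof_nondecreasing _ _ tt'.
have : expR (- 4) * (2 / 3) ^+ 3 <= expinv 3 c by apply: expinv3_ge; lra.
by move: cE; lra.
Qed.

End profile.

Section kernel.
Context {R : realType} {n : nat}.
Variables (T w : R).
Implicit Types (x y z : 'rV[R]_n) (r : R).

(* cutoff z = h (sqnorm z) with h t = w X exp (- 1 / X), X = (T - t) / w, and
   kern z = - h' (sqnorm z). *)
Definition kernel_arg z : R := (T - sqnorm z) / w.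
Definition kern z : R := kprof (kernel_arg z).
Definition cutoff z : R := w * (kernel_arg z * expinv 0 (kernel_arg z)).

Hypothesis w0 : 0 < w.

Lemma kern_ge0 z : 0 <= kern z.
Proof. by rewrite addr_ge0 ?expinv_ge0. Qed.

Lemma kern_eq0 z : T <= sqnorm z -> kern z = 0.
Proof.
move=> Tz; rewrite /kern /kprof !expinv_npos ?addr0//.
  by rewrite /kernel_arg pmulr_lle0 ?invr_gt0// subr_le0.
by rewrite /kernel_arg pmulr_lle0 ?invr_gt0// subr_le0.
Qed.

Lemma cutoff_eq0 z : T <= sqnorm z -> cutoff z = 0.
Proof.
move=> Tz; rewrite /cutoff expinv_npos ?mulr0//.
by rewrite /kernel_arg pmulr_lle0 ?invr_gt0// subr_le0.
Qed.

Lemma cutoff_ge0 z : 0 <= cutoff z.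
Proof.
have [Tz|Tz] := leP T (sqnorm z); first by rewrite cutoff_eq0.
by rewrite !mulr_ge0 ?expinv_ge0 ?invr_ge0 ?subr_ge0 ?ltW.
Qed.

Lemma elementary_kernel_arg : elementary kernel_arg.
Proof.
apply: elementaryM; last exact: elementary_cst.
rewrite (_ : (fun _ => _) = (fun z => T + (-1) * sqnorm z)); last first.
  by apply/funext => z; rewrite mulN1r.
apply: elementaryD; first exact: elementary_cst.
apply: elementaryM; first exact: elementary_cst.
apply: elementary_sum => i.
by apply: (elementaryM (fun z => z ord0 i) (fun z => z ord0 i)); exact: elementary_coord.
Qed.

Lemma elementary_kern : elementary kern.
Proof.
by apply: elementaryD; apply: elementary_expinv; exact: elementary_kernel_arg.
Qed.

Lemma elementary_cutoff : elementary cutoff.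
Proof.
apply: elementaryM; first exact: elementary_cst.
by apply: elementaryM; [|apply: elementary_expinv]; exact: elementary_kernel_arg.
Qed.

Lemma continuous_kern : continuous kern.
Proof. exact: elementary_continuous elementary_kern. Qed.

Lemma continuous_cutoff : continuous cutoff.
Proof. exact: elementary_continuous elementary_cutoff. Qed.

Let phi y r x := cutoff (r^-1 *: (x - y)).

Lemma elementary_affine (f : 'rV[R]_n -> R) y r :
  elementary f -> elementary (fun x => f (r^-1 *: (x - y))).
Proof.
elim=> [c|j|{}f g ef IHf eg IHg|{}f g ef IHf eg IHg|j {}f ef IHf].
- exact: elementary_cst.
- rewrite (_ : (fun _ => _) = (fun x => r^-1 * (x ord0 j + - y ord0 j))); last first.
    by apply/funext => x; rewrite !mxE.
  apply: elementaryM; first exact: elementary_cst.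
  by apply: elementaryD; [exact: elementary_coord|exact: elementary_cst].
- exact: elementaryD.
- exact: elementaryM.
- exact: elementary_expinv.
Qed.

Lemma test_function_cutoff y r : 0 < r -> 0 <= T -> enorm y + r * Num.sqrt T < 1 ->
  test_function (phi y r).
Proof.
move=> r0 T0 yr1.
pose D := [set x : 'rV[R]_n | enorm (x - y) <= r * Num.sqrt T].
have cD : closed D.
  rewrite (_ : D = (fun x => enorm (x - y)) @^-1` [set t | t <= r * Num.sqrt T])//.
  apply: (continuous_closedP _).1; last exact: closed_le.
  move=> x; apply: (@continuous_comp _ _ _ (fun x : 'rV[R]_n => x - y) enorm).
    by apply: (@continuousB _ _ _ (@id 'rV[R]_n) (cst y)); [exact: cvg_id|exact: cst_continuous].
  exact: continuous_enorm.
have DB : D `<=` unit_ball.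
  move=> x /= xy; apply: le_lt_trans yr1; rewrite -[in leLHS](subrK y x) addrC.
  by rewrite (le_trans (enormD _ _))// lerD2l.
have sD : closure [set x | phi y r x != 0] `<=` D.
  rewrite [X in _ `<=` X]((closure_id D).1 cD); apply: closure_subset => x /=.
  apply: contraNT; rewrite -ltNge => h; rewrite /phi cutoff_eq0//.
  rewrite sqnormZ -sqr_enorm -exprMn -[T]sqr_sqrtr// ler_pXn2r ?nnegrE ?sqrtr_ge0//.
    by rewrite ler_pdivlMl// ltW.
  by rewrite mulr_ge0 ?enorm_ge0 ?invr_ge0 ?ltW.
split; last exact: subset_trans sD DB.
- by apply: elementary_smooth; apply: elementary_affine; exact: elementary_cutoff.
- apply: (subclosed_compact _ (compact_closed_ball 1)); first exact: closed_closure.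
  by move=> x /sD/DB /ltW.
Qed.

(** The identity behind the dilation means: the gradient of the rescaled cutoff is a multiple of z
    [kern] z, the field that also appears when u (y + r z) is differentiated in r. *)
Lemma partial_cutoff y r i x : r != 0 ->
  partial i (phi y r) x = - (2 / r) * ((r^-1 *: (x - y)) ord0 i * kern (r^-1 *: (x - y))).
Proof.
move=> r0; rewrite /partial; apply: derive_val.
set z := r^-1 *: (x - y).
have dX : is_derive x (delta_mx ord0 i : 'rV[R]_n)
    (fun x => kernel_arg (r^-1 *: (x - y))) (- (2 / (w * r)) * z ord0 i).
  apply/is_derive_line.
  pose c : R := r^-1 ^+ 2.
  (* Along a coordinate line [kernel_arg] is a quadratic polynomial in t; its linear coefficient is
     the derivative at 0. *)
  rewrite (_ : (fun _ => _) = (fun t : R =>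
      (T - sqnorm z) / w + (t * (- (2 / (w * r)) * z ord0 i) + t * (t * (- (c / w)))))); last first.
    apply/funext => t.
    have -> : r^-1 *: (t *: (delta_mx ord0 i : 'rV[R]_n) + x - y) = z + (t / r) *: delta_mx ord0 i.
      by apply/rowP => j; rewrite /z !mxE; ring.
    rewrite /kernel_arg sqnormD sqnormZ.
    have -> : sqnorm (delta_mx ord0 i : 'rV[R]_n) = 1.
      rewrite /sqnorm (bigD1 i)//= mxE !eqxx expr1n big1 ?addr0// => j ji.
      by rewrite mxE (negPf ji) andbF expr0n.
    have -> : \sum_(j < n) z ord0 j * ((t / r) *: (delta_mx ord0 i : 'rV[R]_n)) ord0 j =
        z ord0 i * (t / r).
      rewrite (bigD1 i)//= !mxE !eqxx mulr1 big1 ?addr0// => j ji.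
      by rewrite !mxE (negPf ji) andbF !mulr0.
    by rewrite /c; field; rewrite r0 gt_eqF.
  have did : is_derive (0 : R) (1 : R) (fun t : R => t) 1 by exact: is_derive_id.
  have dc (a : R) : is_derive (0 : R) (1 : R) (fun=> a) 0 by exact: is_derive_cst.
  have := is_deriveD_fun _ _ _ _ _ _ (dc ((T - sqnorm z) / w)) (is_deriveD_fun _ _ _ _ _ _
    (is_deriveM_fun _ _ _ _ _ _ did (dc (- (2 / (w * r)) * z ord0 i)))
    (is_deriveM_fun _ _ _ _ _ _ did (is_deriveM_fun _ _ _ _ _ _ did (dc (- (c / w)))))).
  by move=> /is_derive_eq; apply; ring.
have dE := is_derive_comp_real (expinv 0) (fun x => kernel_arg (r^-1 *: (x - y))) x _ _ _
  (is_derive_expinv 0 (kernel_arg z)) dX.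
have dc := is_derive_cst w x (delta_mx ord0 i : 'rV[R]_n).
have := is_deriveM_fun _ _ _ _ _ _ dc (is_deriveM_fun _ _ _ _ _ _ dX dE).
rewrite -/z => /is_derive_eq; apply.
(* The derivative of X [expinv 0] X is [expinv 0] X + X [expinv 2] X, and the last term is
   [expinv 1] X: together they make [kprof]. *)
rewrite /= mulr0 addr0 mul0r subr0 /kern /kprof [expinv 1 (kernel_arg z)]expinvS.
by field; rewrite r0 gt_eqF.
Qed.

Lemma kern_le1 z : kern z <= 1.
Proof.
rewrite /kern /kprof; set X := kernel_arg z.
have [X0|X0] := ltP 0 X; last by rewrite !expinv_npos// addr0.
rewrite !expinv_pos// expr0 expr1 -mulrDl expRN ler_pdivrMr ?expR_gt0// mul1r.
exact: expR_ge1Dx.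
Qed.

End kernel.

Section lebn_bounded.
Context {R : realType} {n : nat}.

Lemma open_sqnorm_lt (T : R) : open [set z : 'rV[R]_n | sqnorm z < T].
Proof.
rewrite (_ : [set _ | _] = sqnorm @^-1` [set t | t < T])//.
by apply: open_comp => [x _|]; [exact: continuous_sqnorm|exact: open_lt].
Qed.

Lemma measurable_box (a b : R) :
  measurable [set x : 'rV[R]_n | forall i, `[a, b]%classic (Defs.coord i x)].
Proof.
have -> : [set x : 'rV[R]_n | forall i, `[a, b]%classic (Defs.coord i x)] =
    \bigcap_(i in [set: 'I_n]) (Defs.coord i @^-1` `[a, b]).
  by apply/seteqP; split => [x h i _|x h i]; [exact: h|exact: (h i I)].
apply: fin_bigcap_measurable => // i _.
by rewrite -[X in measurable X]setTI; exact: measurable_coord.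
Qed.

Lemma measurable_sqnorm_lt (T : R) : measurable [set z : 'rV[R]_n | sqnorm z < T].
Proof. by apply: open_measurable_rV; exact: open_sqnorm_lt. Qed.

Lemma lebn_box_itv (a b : R) : a <= b ->
  lebn n [set x : 'rV[R]_n | forall i, `[a, b]%classic (Defs.coord i x)] = ((b - a) ^+ n)%:E.
Proof.
move=> ab; rewrite (@lebn_box R n (fun=> `[a, b]%classic))//.
rewrite lebesgue_measure_itv/= lte_fin.
have -> : (if (a < b)%R then (b%:E - a%:E)%E else 0%E) = (b - a)%:E.
  case: ifPn => //; rewrite -leNgt => ba.
  by rewrite (_ : b = a) ?subrr//; apply/eqP; rewrite eq_le ab ba.
rewrite -[in RHS](card_ord n) -prodr_const.
by elim/big_ind2 : _ => // x1 x2 y1 y2 -> ->.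
Qed.

Lemma lebn_sqnorm_lt (T : R) : (lebn n [set z : 'rV[R]_n | (sqnorm z < T)%R] < +oo)%E.
Proof.
have [T0|T0] := ltP T 0.
  rewrite (_ : [set _ | _] = set0) ?measure0//; apply/seteqP; split => z //=.
  by rewrite ltNge (le_trans (ltW T0) (sqnorm_ge0 _)).
have ab : - Num.sqrt T <= Num.sqrt T by rewrite ge0_cp ?sqrtr_ge0.
apply: le_lt_trans (ltry ((Num.sqrt T - - Num.sqrt T) ^+ n)); rewrite -lebn_box_itv//.
apply: le_measure; rewrite ?inE.
- exact: measurable_sqnorm_lt.
- exact: measurable_box.
- move=> z /= zT i; rewrite /= in_itv/= -ler_norml.
  rewrite (le_trans (ler_coord_enorm z i))// /enorm -/(sqnorm z).
  by rewrite ler_sqrt// ltW.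
Qed.

Lemma integrable_bounded (D : set 'rV[R]_n) (T C : R) (f : 'rV[R]_n -> R) :
  measurable D -> D `<=` [set z | sqnorm z < T] -> measurable_fun D f ->
  (forall z, D z -> `|f z| <= C) -> (lebn n).-integrable D (EFin \o f).
Proof.
move=> mD DT mf fC; apply: measurable_bounded_integrable => //.
  apply: le_lt_trans (lebn_sqnorm_lt T); apply: le_measure; rewrite ?inE//.
  exact: measurable_sqnorm_lt.
exists C; split; first exact: num_real.
by move=> x Cx z Dz /=; rewrite (le_trans (fC _ Dz))// ltW.
Qed.

Lemma integral_affine (y : 'rV[R]_n) (r : R) (F : 'rV[R]_n -> \bar R) :
  r != 0 -> (lebn n).-integrable setT F ->
  (\int[lebn n]_x F x = (`|r| ^+ n)%:E * \int[lebn n]_z F (y + r *: z)%R)%E.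
Proof.
move=> r0 iF; have mF := measurable_int _ iF.
have rn0 : 0 < `|r| ^+ n by rewrite exprn_gt0// normr_gt0.
(* Finiteness passes to the dilated integral because |r|^n is positive; it is needed to distribute
   this factor over the positive and negative parts. *)
have fin (G : 'rV[R]_n -> \bar R) : measurable_fun setT G -> (forall x, 0 <= G x)%E ->
    (\int[lebn n]_x G x \is a fin_num)%E ->
    (\int[lebn n]_z G (y + r *: z)%R \is a fin_num)%E.
  move=> mG G0; rewrite (ge0_integral_affine y r G r0 mG G0).
  have : (0 <= \int[lebn n]_z G (y + r *: z)%R)%E by apply: integral_ge0.
  by case: (\int[lebn n]_z _)%E => // _; rewrite mulry gtr0_sg// mul1e.
rewrite [LHS]integralE [X in _ = (_ * X)%E]integralE.
rewrite (ge0_integral_affine y r _ r0 (measurable_funepos mF))//.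
rewrite (ge0_integral_affine y r _ r0 (measurable_funeneg mF))//.
have := fin _ (measurable_funeneg mF) (fun x => funeneg_ge0 F x)
  (integrable_neg_fin_num measurableT iF).
move=> fn; rewrite -muleBr//; last by apply: fin_num_adde_defl; rewrite fin_numN.
congr (_ * (_ - _))%E; apply: eq_integral => z _.
  by rewrite !funeposE.
by rewrite !funenegE.
Qed.

End lebn_bounded.

(** * Dilation means *)

Section C1.
Context {R : realType} {n : nat}.
Variables (U : set 'rV[R]_n) (f : 'rV[R]_n -> R) (g : 'I_n -> 'rV[R]_n -> R).
Hypothesis oU : open U.
Hypothesis df : forall i x, U x -> is_derive x (delta_mx ord0 i : 'rV[R]_n) f (g i x).
Hypothesis cg : forall i x, U x -> {for x, continuous (g i)}.

Let MVT_coord (p : 'rV[R]_n) (i : 'I_n) (s : R) :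
  (forall t : R, 0 <= t <= 1 -> U (p + (t * s) *: delta_mx ord0 i)) ->
  exists2 t : R, 0 <= t <= 1 &
    f (p + s *: delta_mx ord0 i) - f p = s * g i (p + (t * s) *: delta_mx ord0 i).
Proof.
move=> Up; pose F (t : R) := f (p + (t * s) *: delta_mx ord0 i).
have dF (t : R) : 0 <= t <= 1 -> is_derive t 1 F (g i (p + (t * s) *: delta_mx ord0 i) * s).
  move=> t01; have /is_derive_line dfi := df i _ (Up _ t01).
  have did : is_derive t (1 : R) (fun t : R => t) 1 by exact: is_derive_id.
  have dc (a : R) : is_derive t (1 : R) (fun=> a) 0 by exact: is_derive_cst.
  have dk : is_derive t 1 (fun t' : R => (t' + - t) * s) s.
    apply: is_derive_eq (is_deriveM_fun _ _ _ _ _ _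
      (is_deriveD_fun _ _ _ _ _ _ did (dc (- t))) (dc s)) _.
    by ring.
  pose G (a : R) := f (a *: (delta_mx ord0 i : 'rV[R]_n) + (p + (t * s) *: delta_mx ord0 i)).
  have -> : F = (fun t' : R => G ((t' + - t) * s)).
    apply/funext => t'; rewrite /F /G; congr f.
    by apply/rowP => j; rewrite !mxE; ring.
  by apply: (is_derive1_comp_fun G _ t _ _ _ dk); rewrite subrr mul0r.
have [||t t01 tE] := @MVT_segment R F (fun t => g i (p + (t * s) *: delta_mx ord0 i) * s) 0 1 ler01.
- by move=> t; rewrite in_itv/= => /andP[t0 t1]; apply: dF; rewrite !ltW.
- apply: derivable_within_continuous => t; rewrite in_itv/= => t01.
  by apply: ex_derive; exact: dF.
exists t; first by rewrite in_itv/= in t01.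
by move: tE; rewrite /F mul1r mul0r scale0r addr0 subr0 mulr1 mulrC.
Qed.

(** Coordinates are changed one at a time: [hm m] keeps the first m entries of h, and [MVT_coord]
    treats each increment without leaving the cube of radius d about x. *)
Let approx (x : 'rV[R]_n) (e : R) : U x -> 0 < e -> exists2 d : R, 0 < d &
  forall h : 'rV[R]_n, (forall i, `|h ord0 i| < d) ->
  `|f (x + h) - f x - \sum_(i < n) h ord0 i * g i x| <= e * \sum_(i < n) `|h ord0 i|.
Proof.
move=> Ux e0.
have : \forall x' \near x, U x' /\ forall i, `|g i x - g i x'| < e.
  near=> x'; split; first by near: x'; exact: open_nbhs_nbhs.
  near: x'; apply: filter_forall => i.
  by have /cvgrPdist_lt := cg i _ Ux; apply.
move=> /nbhs_ballP[d /= d0 dP]; exists d => // h hd.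
pose hm (m : nat) : 'rV[R]_n := \row_i (if (i < m)%N then h ord0 i else 0).
have near_x (q : 'rV[R]_n) : (forall i, `|q ord0 i| <= `|h ord0 i|) ->
    U (x + q) /\ forall i, `|g i x - g i (x + q)| < e.
  move=> qh; apply: dP; rewrite /ball/= /mx_ball; split => // i j.
  rewrite (ord1 i) /ball/= !mxE opprD addrA subrr add0r normrN.
  exact: le_lt_trans (qh j) (hd j).
suff key m : (m <= n)%N ->
    `|f (x + hm m) - f x - \sum_(i < n | (i < m)%N) h ord0 i * g i x| <=
    e * \sum_(i < n | (i < m)%N) `|h ord0 i|.
  have -> : x + h = x + hm n by congr (_ + _); apply/rowP => i; rewrite mxE ltn_ord.
  have E (F : 'I_n -> R) : \sum_(i < n | (i < n)%N) F i = \sum_(i < n) F i.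
    by apply: eq_bigl => i; rewrite ltn_ord.
  by have := key _ (leqnn n); rewrite !E.
elim: m => [_|m IH mn].
  rewrite !big_pred0// mulr0 subr0 (_ : hm 0%N = 0) ?addr0 ?subrr ?normr0//.
  by apply/rowP => i; rewrite !mxE.
pose i0 := Ordinal mn.
have hmS : hm m.+1 = hm m + h ord0 i0 *: delta_mx ord0 i0.
  apply/rowP => i; rewrite !mxE eqxx/= ltnS leq_eqVlt.
  have [->|ii0] := eqVneq i i0; first by rewrite /= eqxx ltnn mulr1 add0r.
  rewrite mulr0 addr0 (_ : (i == m :> nat) = false)//.
  by apply/negbTE; apply: contra ii0 => /eqP im; exact/eqP/val_inj.
have bound (t : R) : 0 <= t <= 1 -> forall i,
    `|(hm m + (t * h ord0 i0) *: delta_mx ord0 i0) ord0 i| <= `|h ord0 i|.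
  move=> /andP[t0 t1] i; rewrite !mxE eqxx/=.
  have [->|ii0] := eqVneq i i0; last first.
    by rewrite mulr0 addr0; case: ifPn => //; rewrite normr0.
  by rewrite ltnn add0r mulr1 normrM ger0_norm// ler_piMl.
have [|t t01 tE] := MVT_coord (x + hm m) i0 (h ord0 i0).
  by move=> t t01; rewrite -addrA; have [] := near_x _ (bound t t01).
have /(_ i0) gi0 := (near_x _ (bound t t01)).2.
rewrite (bigD1 i0)//= [in leRHS](bigD1 i0)//= mulrDr.
have E : (fun i : 'I_n => (i < m.+1)%N && (i != i0)) =1 (fun i => (i < m)%N).
  move=> i /=; rewrite ltnS leq_eqVlt; have [->|ii0] := eqVneq i i0.
    by rewrite andbF ltnn.
  rewrite andbT (_ : (i == m :> nat) = false)//.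
  by apply/negbTE; apply: contra ii0 => /eqP im; exact/eqP/val_inj.
rewrite (eq_bigl _ _ E) [in leRHS](eq_bigl _ _ E).
set S := \sum_(_ < _ | _) _ in IH *; set S' := \sum_(_ < _ | _) _ in IH *.
have -> : f (x + hm m.+1) - f x - (h ord0 i0 * g i0 x + S) =
    h ord0 i0 * (g i0 (x + hm m + (t * h ord0 i0) *: delta_mx ord0 i0) - g i0 x) +
    (f (x + hm m) - f x - S).
  by rewrite mulrBr -tE hmS addrA; ring.
rewrite (le_trans (ler_normD _ _))// lerD ?IH 1?ltnW//.
rewrite normrM mulrC ler_wpM2r// ltW// distrC.
by move: gi0; rewrite addrA.
Unshelve. all: by end_near. Qed.

(** Continuity of the partial derivatives gives derivatives in all directions; the derivative of u
    (y + r z) in r needs them for arbitrary z. *)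
Lemma C1_is_derive x h : U x -> is_derive x h f (\sum_(i < n) h ord0 i * g i x).
Proof.
move=> Ux.
suff cv : (fun t : R => t^-1 *: ((f \o shift x) (t *: h) - f x)) @ 0^' -->
    (\sum_(i < n) h ord0 i * g i x : R).
  by split; [apply/cvg_ex; eexists; exact: cv|exact: cvg_lim cv].
apply/cvgrPdist_le => e e0.
(* The summand 1 keeps S positive when h = 0 and makes S exceed every |h_i|. *)
pose S := 1 + \sum_(i < n) `|h ord0 i|.
have S0 : 0 < S by rewrite ltr_pwDl// sumr_ge0.
have hS i : `|h ord0 i| < S.
  rewrite /S (bigD1 i)//= addrCA ltrDl ltr_pwDl// sumr_ge0//.
have [d d0 dP] := approx x (e / S) Ux (divr_gt0 e0 S0).
near=> t.
have t0 : t != 0 by near: t; exact: nbhs_dnbhs_neq.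
have td : `|t| < d / S.
  near: t; apply: nbhs_dnbhs.
  apply: filterS (nbhsx_ballx (0 : R) (d / S) (divr_gt0 d0 S0)) => z.
  by rewrite /ball/= sub0r normrN.
have /dP : forall i, `|(t *: h) ord0 i| < d.
  move=> i; rewrite mxE normrM (le_lt_trans (ler_wpM2l _ (ltW (hS i))))//.
  by rewrite -ltr_pdivlMr.
have -> : \sum_(i < n) (t *: h) ord0 i * g i x = t * \sum_(i < n) h ord0 i * g i x.
  by rewrite mulr_sumr; apply: eq_bigr => i _; rewrite mxE mulrA.
have -> : \sum_(i < n) `|(t *: h) ord0 i| = `|t| * \sum_(i < n) `|h ord0 i|.
  by rewrite mulr_sumr; apply: eq_bigr => i _; rewrite mxE normrM.
move=> H; rewrite /= distrC -(ler_pM2l (x := `|t|)) ?normr_gt0// -normrM.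
rewrite /GRing.scale/= mulrBr mulVKf// [t *: h + x]addrC.
apply: le_trans H _; rewrite mulrCA ler_wpM2l//.
rewrite mulrAC ler_pdivrMr//; apply: ler_wpM2l; first exact: ltW.
by rewrite /S lerDr.
Unshelve. all: by end_near. Qed.

End C1.

Definition kern_mass {R : realType} (n : nat) (T w : R) : R :=
  \int[lebn n]_z kern T w z.

Definition cutoff_mass {R : realType} (n : nat) (T w : R) : R :=
  \int[lebn n]_z cutoff T w z.

Section masses.
Context {R : realType} {n : nat}.

Lemma integrable_supported (T C : R) (f : 'rV[R]_n -> R) :
  measurable_fun setT f -> (forall z, T <= sqnorm z -> f z = 0) ->
  (forall z, `|f z| <= C) -> (lebn n).-integrable setT (EFin \o f).
Proof.
move=> mf f0 fC; pose D := [set z : 'rV[R]_n | sqnorm z < T].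
have mD : measurable D by exact: measurable_sqnorm_lt.
rewrite (_ : EFin \o f = (EFin \o f) \_ D); last first.
  apply/funext => z; rewrite patchE; case: ifPn => //; rewrite notin_setE /D/= => /negP.
  by rewrite -leNgt => ?; rewrite f0.
apply/integrable_restrict => //; rewrite setTI.
by apply: (integrable_bounded D T C) => //; exact: measurable_funTS.
Qed.

Variables (T w : R).
Hypotheses (w0 : 0 < w).

Lemma integrable_kern : (lebn n).-integrable setT (EFin \o kern T w).
Proof.
apply: (integrable_supported T 1) => [|z|z].
- by apply: continuous_measurable_rV; exact: continuous_kern.
- exact: kern_eq0.
- by rewrite ger0_norm ?kern_ge0 ?kern_le1.
Qed.

Lemma integrable_cutoff : (lebn n).-integrable setT (EFin \o cutoff T w).
Proof.
apply: (integrable_supported T `|T|) => [|z|z].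
- by apply: continuous_measurable_rV; exact: continuous_cutoff.
- exact: cutoff_eq0.
- rewrite ger0_norm ?cutoff_ge0//.
  have [Tz|zT] := leP T (sqnorm z); first by rewrite cutoff_eq0.
  have X0 : 0 < T - sqnorm z by rewrite subr_gt0.
  rewrite /cutoff /kernel_arg mulrA [w * _]mulrC divfK ?gt_eqF//.
  rewrite -[leRHS]mulr1 ler_pM ?expinv_ge0 ?(ltW X0)//; last exact: expinv_le_fact.
  by rewrite (le_trans _ (ler_norm T))// gerBl sqnorm_ge0.
Qed.

Lemma cutoff_massE : (\int[lebn n]_z (cutoff T w z)%:E = (cutoff_mass n T w)%:E)%E.
Proof. by rewrite fineK//; exact: integrable_fin_num integrable_cutoff. Qed.

Lemma kern_massE : (\int[lebn n]_z (kern T w z)%:E = (kern_mass n T w)%:E)%E.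
Proof. by rewrite fineK//; exact: integrable_fin_num integrable_kern. Qed.

Lemma cutoff_mass_ge0 : 0 <= cutoff_mass n T w.
Proof.
rewrite -lee_fin -cutoff_massE; apply: integral_ge0 => z _.
by rewrite lee_fin cutoff_ge0.
Qed.

End masses.

Section supersolution.
Context {R : realType} {n : nat}.
Implicit Types (x y z : 'rV[R]_n) (r : R).

Lemma within_closed_ball_continuous (f : 'rV[R]_n -> R) x :
  {within closed_unit_ball, continuous f} -> unit_ball x -> {for x, continuous f}.
Proof.
move=> cf Bx.
have : {within unit_ball, continuous f}.
  by apply: continuous_subspaceW cf => z /= /ltW.
by rewrite continuous_open_subspace; [apply; rewrite inE|exact: open_unit_ball].
Qed.

Lemma within_closed_ball_bounded (f : 'rV[R]_n -> R) :
  {within closed_unit_ball, continuous f} ->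
  exists2 C : R, 0 <= C & forall x, closed_unit_ball x -> `|f x| <= C.
Proof.
move=> cf.
have [||c _ cP] :=
  @compact_EVT_max _ R (Num.norm \o f) (@closed_unit_ball R n) _ (compact_closed_ball 1).
- by exists 0; rewrite /closed_unit_ball/= enorm0.
- move=> x; apply: (@continuous_comp (subspace closed_unit_ball) R R f Num.norm); first exact: cf.
  exact: norm_continuous.
exists `|f c| => // x Bx; apply: cP.
by rewrite inE.
Qed.

Lemma continuous_at_sum (I : Type) (s : seq I) (F : I -> 'rV[R]_n -> R) z :
  (forall i, {for z, continuous (F i)}) ->
  {for z, continuous (fun x => \sum_(i <- s) F i x)}.
Proof.
move=> cF; elim: s => [|i s IH].
  rewrite (_ : (fun _ => _) = cst 0); first exact: cst_continuous.
  by apply/funext => x; rewrite big_nil.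
rewrite (_ : (fun _ => _) = (fun x => F i x + \sum_(j <- s) F j x)).
  exact: (continuousD (cF i) IH).
by apply/funext => x; rewrite big_cons.
Qed.

Lemma measurable_unit_ball : measurable (@unit_ball R n).
Proof. by apply: open_measurable_rV; exact: open_unit_ball. Qed.

Lemma affine_rVK y r x : r != 0 -> y + r *: (r^-1 *: (x - y)) = x.
Proof. by move=> r0; rewrite scalerA mulfV// scale1r addrC subrK. Qed.

Lemma affine_rVKV y r z : r != 0 -> r^-1 *: (y + r *: z - y) = z.
Proof. by move=> r0; rewrite [y + _]addrC addrK scalerA mulVf// scale1r. Qed.

Lemma continuous_affine_rV y r : continuous (fun z => y + r *: z).
Proof.
move=> z; apply: (@continuousD _ _ _ (cst y) (fun z => r *: z)).
  exact: cst_continuous.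
exact: scaler_continuous.
Qed.

(* u has the continuous gradient g on the open ball, and 0 <= Laplacian u <= A
   weakly, the Laplacian being the nonnegative one. *)
Record supersolution (A : R) (u : 'rV[R]_n -> R) (g : 'I_n -> 'rV[R]_n -> R) : Prop := {
  ss_continuous : {within closed_unit_ball, continuous u};
  ss_continuous_grad : forall i, {within closed_unit_ball, continuous (g i)};
  ss_derive : forall i x, unit_ball x -> is_derive x (delta_mx ord0 i : 'rV[R]_n) u (g i x);
  ss_ge0 : 0 <= A;
  ss_weak : forall phi, test_function phi -> (forall x, 0 <= phi x) ->
    (0 <= \int[lebn n]_(x in unit_ball) (\sum_(i < n) partial i u x * partial i phi x)%:E <=
      A%:E * \int[lebn n]_(x in unit_ball) (phi x)%:E)%E }.

(* u is extended by 0 outside the ball. *)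
Definition kern_mean (u : 'rV[R]_n -> R) (T w : R) y r : \bar R :=
  (\int[lebn n]_z ((u \_ unit_ball) (y + r *: z) * kern T w z)%:E)%E.

Section dilation.
Variables (A : R) (u : 'rV[R]_n -> R) (g : 'I_n -> 'rV[R]_n -> R).
Hypothesis ss : supersolution A u g.
Variables (T w : R).
Hypotheses (T0 : 0 < T) (w0 : 0 < w).
Variables (y : 'rV[R]_n) (r2 : R).
Hypotheses (r20 : 0 < r2) (yr2 : enorm y + r2 * Num.sqrt T < 1).

Let D : set 'rV[R]_n := [set z | sqnorm z < T].
Let k : 'rV[R]_n -> R := kern T w.

(** [r2] strictly bounds the radii in use, so that they lie in an open interval around 0 on which
    the integrand can be differentiated in r. *)
Lemma dilation_in_ball r z : `|r| < r2 -> sqnorm z < T -> unit_ball (y + r *: z).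
Proof.
move=> rr2 zT; apply: le_lt_trans yr2; rewrite (le_trans (enormD _ _))// lerD2l enormZ.
rewrite ler_pM ?enorm_ge0//; first exact: ltW.
by rewrite enorm_le_sqnorm ?sqrtr_ge0// sqr_sqrtr ltW.
Qed.

Let F r z := u (y + r *: z) * k z.
Let dF r z := (\sum_(i < n) z ord0 i * g i (y + r *: z)) * k z.

Let oD : open D. Proof. exact: open_sqnorm_lt. Qed.

Let mD : measurable D. Proof. exact: open_measurable_rV. Qed.

Let cu r z : `|r| < r2 -> D z -> forall f : 'rV[R]_n -> R, {within closed_unit_ball, continuous f} ->
  {for z, continuous (fun z => f (y + r *: z))}.
Proof.
move=> rr2 Dz f cf; apply: (@continuous_comp _ _ _ (fun z => y + r *: z) f).
  exact: continuous_affine_rV.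
by apply: within_closed_ball_continuous => //; exact: dilation_in_ball.
Qed.

Let mF r : `|r| < r2 -> measurable_fun D (F r).
Proof.
move=> rr2; apply: open_continuous_measurable_rV => // z /[!inE] Dz.
apply: continuousM; last exact: continuous_kern.
by apply: cu => //; exact: ss_continuous ss.
Qed.

Let mdF r : `|r| < r2 -> measurable_fun D (dF r).
Proof.
move=> rr2; apply: open_continuous_measurable_rV => // z /[!inE] Dz.
apply: continuousM; last exact: continuous_kern.
apply: continuous_at_sum => i.
apply: (@continuousM _ _ (fun z => z ord0 i) (fun z => g i (y + r *: z))).
  exact: coord_continuous.
by apply: cu => //; exact: ss_continuous_grad ss i.
Qed.

Let k_ge0 z : 0 <= k z. Proof. exact: kern_ge0. Qed.
Let k_le1 z : k z <= 1. Proof. exact: kern_le1. Qed.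

Let F_bounded : exists2 C : R, 0 <= C & forall r z, `|r| < r2 -> D z -> `|F r z| <= C.
Proof.
have [C C0 CP] := within_closed_ball_bounded _ (ss_continuous _ _ _ ss).
exists C => // r z rr2 Dz; rewrite normrM -[leRHS]mulr1 ler_pM//.
  by apply: CP; rewrite /closed_unit_ball/= ltW//; exact: dilation_in_ball.
by rewrite ger0_norm.
Qed.

Let dF_bounded : exists2 C : R, 0 <= C & forall r z, `|r| < r2 -> D z -> `|dF r z| <= C.
Proof.
have /(_ _)/cid2-/all_sig2[C C0 CP] i := within_closed_ball_bounded _ (ss_continuous_grad _ _ _ ss i).
exists (\sum_(i < n) Num.sqrt T * C i) => [|r z rr2 Dz].
  by apply: sumr_ge0 => i _; rewrite mulr_ge0 ?sqrtr_ge0.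
rewrite normrM -[leRHS]mulr1 ler_pM//; last by rewrite ger0_norm.
rewrite (le_trans (ler_norm_sum _ _ _))// ler_sum// => i _.
rewrite normrM ler_pM//.
  rewrite (le_trans (ler_coord_enorm z i))//.
  by rewrite enorm_le_sqnorm ?sqrtr_ge0// sqr_sqrtr ltW.
by apply: CP; rewrite /closed_unit_ball/= ltW//; exact: dilation_in_ball.
Qed.

Let iF r : `|r| < r2 -> (lebn n).-integrable D (EFin \o F r).
Proof.
move=> rr2; have [C C0 CP] := F_bounded.
by apply: (integrable_bounded D T C) => //; [exact: mF|move=> z; exact: CP].
Qed.

Let idF r : `|r| < r2 -> (lebn n).-integrable D (EFin \o dF r).
Proof.
move=> rr2; have [C C0 CP] := dF_bounded.
by apply: (integrable_bounded D T C) => //; [exact: mdF|move=> z; exact: CP].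
Qed.

Let is_derive_F r z : `|r| < r2 -> D z -> is_derive r 1 (F ^~ z) (dF r z).
Proof.
move=> rr2 Dz.
have /is_derive_line du := C1_is_derive unit_ball u g open_unit_ball (ss_derive _ _ _ ss)
  (fun i x Bx => within_closed_ball_continuous _ x (ss_continuous_grad _ _ _ ss i) Bx)
  (y + r *: z) z (dilation_in_ball r z rr2 Dz).
have did : is_derive r (1 : R) (fun t : R => t) 1 by exact: is_derive_id.
have dc (a : R) : is_derive r (1 : R) (fun=> a) 0 by exact: is_derive_cst.
pose G (a : R) := u (a *: z + (y + r *: z)).
rewrite (_ : F ^~ z = (fun t => G (t + - r) * k z)); last first.
  by apply/funext => t; rewrite /F /G; congr (u _ * _); apply/rowP => i; rewrite !mxE; ring.
have dG : is_derive r 1 (fun t => G (t + - r)) ((\sum_(i < n) z ord0 i * g i (y + r *: z)) * (1 + 0)).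
  by apply: (is_derive1_comp_fun G _ r _ _ _ (is_deriveD_fun _ _ _ _ _ _ did (dc _))); rewrite subrr.
apply: is_derive_eq (is_deriveM_fun _ _ _ _ _ _ dG (dc (k z))) _.
by rewrite /dF; ring.
Qed.

Let U r : R := \int[lebn n]_(z in D) F r z.
Let dU r : R := \int[lebn n]_(z in D) dF r z.

Let is_derive_U r : `|r| < r2 -> is_derive r 1 U (dU r).
Proof.
move=> rr2; have [C C0 CP] := dF_bounded.
have Ir : `]- r2, r2[%classic r by rewrite /= in_itv/= -ltr_norml.
have I1 (x : R) : `]- r2, r2[%classic x -> (lebn n).-integrable D (EFin \o F x).
  by rewrite /= in_itv/= -ltr_norml; exact: iF.
have I2 (x : R) z : `]- r2, r2[%classic x -> D z -> derivable (F ^~ z) x 1.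
  by rewrite /= in_itv/= -ltr_norml => xr Dz; have [] := is_derive_F _ _ xr Dz.
have E (x : R) z : `|x| < r2 -> D z -> partial1of2 F x z = dF x z.
  by move=> xr Dz; rewrite partial1of2E; have [_ ->] := is_derive_F _ _ xr Dz.
have I3 : (lebn n).-integrable D (EFin \o cst C).
  by apply: (integrable_bounded D T C) => // z _; rewrite ger0_norm.
have I4 (x : R) z : `]- r2, r2[%classic x -> D z -> `|partial1of2 F x z| <= cst C z.
  by rewrite /= in_itv/= -ltr_norml => xr Dz; rewrite E//; exact: CP.
split.
  exact: (derivable_under_integral mD Ir I1 I2 (fun=> C0) I3 I4).
have := differentiation_under_integral mD Ir I1 I2 (fun=> C0) I3 I4.
rewrite derive1E => ->; apply: eq_Rintegral => z /[!inE] Dz.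
exact: E.
Qed.

Let phi r x := cutoff T w (r^-1 *: (x - y)).

(* Tested against phi r, the weak Laplacian of u is - 2 r^(n-1) U'(r). *)
Let dU_bounds r : 0 < r < r2 -> - (A * cutoff_mass n T w * r / 2) <= dU r <= 0.
Proof.
move=> /andP[r0 rr2]; have rr2' : `|r| < r2 by rewrite gtr0_norm.
have yr : enorm y + r * Num.sqrt T < 1.
  by apply: lt_trans yr2; rewrite ltrD2l ltr_pM2r// sqrtr_gt0.
have tphi := test_function_cutoff T w w0 y r r0 (ltW T0) yr.
have /andP[lo hi] := ss_weak _ _ _ ss _ tphi (fun x => cutoff_ge0 T w w0 _).
have rn : 0 < r ^+ n by rewrite exprn_gt0.
pose H x := (\sum_(i < n) partial i u x * partial i (phi r) x).
have HE z : D z -> H (y + r *: z) = - (2 / r) * dF r z.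
  move=> Dz; rewrite /H /dF mulr_suml mulr_sumr; apply: eq_bigr => i _.
  rewrite /phi partial_cutoff ?gt_eqF// affine_rVKV ?gt_eqF//.
  have [_] := ss_derive _ _ _ ss i _ (dilation_in_ball r z rr2' Dz).
  rewrite /partial => ->.
  by rewrite -/k; ring.
have H0 z : ~ D z -> H (y + r *: z) = 0.
  move=> /negP; rewrite -leNgt => Tz; rewrite /H big1// => i _.
  rewrite /phi partial_cutoff ?gt_eqF// affine_rVKV ?gt_eqF//.
  by rewrite kern_eq0// !mulr0.
(* In the open ball [partial i u] coincides with the continuous [g i], so H agrees near each point
   with a function continuous there. *)
have mH : measurable_fun unit_ball H.
  apply: open_continuous_measurable_rV => [|x]; first exact: open_unit_ball.
  rewrite inE => Bx.
  have c1 (i : 'I_n) : {for x, continuous (fun x : 'rV[R]_n =>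
      - (2 / r) * ((r^-1 *: (x - y)) ord0 i * kern T w (r^-1 *: (x - y))))}.
    apply: elementary_continuous; apply: elementaryM; first exact: elementary_cst.
    apply: (elementary_affine (fun z => z ord0 i * kern T w z)).
    apply: elementaryM; first exact: elementary_coord.
    exact: elementary_kern.
  have c2 : {for x, continuous (fun x => \sum_(i < n) g i x * (- (2 / r) *
      ((r^-1 *: (x - y)) ord0 i * kern T w (r^-1 *: (x - y)))))}.
    apply: continuous_at_sum => i; apply: continuousM; last exact: c1.
    by apply: within_closed_ball_continuous => //; exact: ss_continuous_grad ss i.
  have : \forall x' \near x, (fun x => \sum_(i < n) g i x * (- (2 / r) *
      ((r^-1 *: (x - y)) ord0 i * kern T w (r^-1 *: (x - y))))) x' = H x'.
    have nB : nbhs x unit_ball by apply: open_nbhs_nbhs; split => //; exact: open_unit_ball.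
    near=> x'; rewrite /H; apply: eq_bigr => i _.
    have Bx' : unit_ball x' by near: x'.
    have [_ ux'] := ss_derive _ _ _ ss i _ Bx'.
    by rewrite /phi partial_cutoff ?gt_eqF// /partial ux'.
  move=> near_eq; rewrite /continuous_at -(nbhs_singleton near_eq).
  exact: cvg_trans (near_eq_cvg near_eq) c2.
have [C C0 CP] := dF_bounded.
have H0B x : ~ D (r^-1 *: (x - y)) -> H x = 0.
  by move=> nDz; rewrite -(affine_rVK y r x) ?gt_eqF//; exact: H0.
have iH : (lebn n).-integrable unit_ball (EFin \o H).
  apply: (integrable_bounded unit_ball 1 (2 / r * C)) => //.
  - exact: measurable_unit_ball.
  - by move=> x; rewrite /unit_ball/= enorm_lt_sqnorm// expr1n.
  - move=> x Bx; pose z := r^-1 *: (x - y).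
    have [Dz|nDz] := pselect (D z); last by rewrite H0B// normr0 mulr_ge0 ?divr_ge0 ?(ltW r0).
    have <- : y + r *: z = x by rewrite affine_rVK ?gt_eqF.
    have r20' : 0 <= 2 / r by rewrite divr_ge0 ?(ltW r0).
    rewrite HE// normrM normrN [`|2 / r|]ger0_norm//.
    by apply: ler_wpM2l => //; exact: CP.
have E1 : (\int[lebn n]_(x in unit_ball) (H x)%:E = ((r ^+ n) * (- (2 / r) * dU r))%:E)%E.
  rewrite integral_mkcond (integral_affine y r) ?gt_eqF//; last first.
    by apply/integrable_restrict; rewrite ?setTI//; exact: measurable_unit_ball.
  rewrite gtr0_norm// [RHS]EFinM; congr (_ * _)%E.
  transitivity (\int[lebn n]_(z in D) (- (2 / r) * dF r z)%:E)%E.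
    rewrite [RHS]integral_mkcond; apply: eq_integral => z _.
    rewrite !patchE; have [Dz|nDz] := pselect (D z).
      rewrite !mem_set//; last exact: dilation_in_ball.
      by rewrite HE.
    by rewrite (memNset nDz) H0// if_same.
  rewrite EFinM /dU; under eq_integral do rewrite EFinM.
  by rewrite integralZl//; [rewrite fineK//; apply: integrable_fin_num => //|]; exact: idF.
(* The mass of the rescaled cutoff scales like r^n, the tested Laplacian like r^(n-1) U'(r): hence
   the factor r in the lower bound. *)
have E2 : (\int[lebn n]_(x in unit_ball) (phi r x)%:E <= (r ^+ n * cutoff_mass n T w)%:E)%E.
  have mphi : measurable_fun setT (EFin \o phi r).
    apply/measurable_EFinP; apply: continuous_measurable_rV.
    by apply: elementary_continuous; apply: elementary_affine; exact: elementary_cutoff.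
  apply: (@le_trans _ _ (\int[lebn n]_x (phi r x)%:E)%E).
    apply: ge0_subset_integral => //.
    - exact: measurable_unit_ball.
    - by move=> x _; rewrite lee_fin cutoff_ge0.
  rewrite (ge0_integral_affine y r) ?gt_eqF//; last by move=> x; rewrite lee_fin cutoff_ge0.
  have -> : (\int[lebn n]_z (phi r (y + r *: z))%:E = (cutoff_mass n T w)%:E)%E.
    rewrite -(cutoff_massE T w w0); apply: eq_integral => z _.
    by rewrite /phi affine_rVKV ?gt_eqF.
  by rewrite (gtr0_norm r0) EFinM.
move: lo hi; rewrite E1 lee_fin => lo hi.
have {}hi : r ^+ n * (- (2 / r) * dU r) <= A * (r ^+ n * cutoff_mass n T w).
  rewrite -lee_fin (le_trans hi)// EFinM lee_wpmul2l// lee_fin.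
  exact: ss_ge0 ss.
move: lo; rewrite pmulr_rge0// mulNr oppr_ge0 pmulr_rle0 ?divr_gt0// => lo.
rewrite lo andbT; move: hi; rewrite [leRHS]mulrCA ler_pM2l// mulNr lerNl => hi.
rewrite -(ler_pM2l (divr_gt0 (ltr0n R 2) r0)).
apply: le_trans hi; rewrite le_eqVlt; apply/orP; left; apply/eqP.
by field; rewrite gt_eqF.
Unshelve. all: by end_near. Qed.

Let U_MVT r s : 0 <= r -> r < s -> s < r2 ->
  exists2 c, r < c < s & U s - U r = dU c * (s - r).
Proof.
move=> r0 rs sr2.
have d (x : R) : r <= x <= s -> is_derive x 1 U (dU x).
  move=> /andP[rx xs]; apply: is_derive_U; rewrite ger0_norm ?(le_trans r0)//.
  exact: le_lt_trans sr2.
have [||c cI cE] := @MVT R U dU r s rs.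
- by move=> x /[!in_itv]/= /andP[rx xs]; apply: d; rewrite !ltW.
- apply: derivable_within_continuous => x /[!in_itv]/= xI.
  by have [] := d _ xI.
- by exists c => //; move: cI; rewrite in_itv.
Qed.

Let U_nonincreasing r s : 0 <= r -> r <= s -> s < r2 -> U s <= U r.
Proof.
move=> r0; rewrite le_eqVlt => /predU1P[->//|rs] sr2.
have [c /andP[rc cs] cE] := U_MVT r s r0 rs sr2.
have /andP[_ dc0] : - (A * cutoff_mass n T w * c / 2) <= dU c <= 0.
  by apply: dU_bounds; rewrite (le_lt_trans r0 rc) (lt_trans cs).
by rewrite -subr_le0 cE mulr_le0_ge0// subr_ge0 ltW.
Qed.

(** Mean value theorem on [0, s], the intermediate radius being bounded by s; integrating the bound
    would give s^2 / 4, a gain of no consequence. *)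
Let U_lower s : 0 <= s -> s < r2 -> U 0 <= U s + A * cutoff_mass n T w * s ^+ 2 / 2.
Proof.
rewrite le_eqVlt => /predU1P[<-|s0] sr2; first by rewrite expr0n/= mulr0 mul0r addr0.
have [c /andP[rc cs] cE] := U_MVT 0 s (lexx _) s0 sr2.
have /andP[dc _] : - (A * cutoff_mass n T w * c / 2) <= dU c <= 0.
  by apply: dU_bounds; rewrite rc (lt_trans cs).
set a := A * cutoff_mass n T w in dc *.
have a0 : 0 <= a by rewrite mulr_ge0 ?cutoff_mass_ge0//; exact: ss_ge0 ss.
have h1 : - (a * c / 2) * s <= dU c * s by rewrite ler_wpM2r// ltW.
have h2 : a * c * s <= a * s * s by rewrite ler_wpM2r ?(ltW s0)// ler_wpM2l// ltW.
rewrite subr0 in cE; rewrite expr2.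
lra.
Qed.

Let kern_meanE r : `|r| < r2 -> kern_mean u T w y r = (U r)%:E.
Proof.
move=> rr2; rewrite fineK; last exact: integrable_fin_num (iF r rr2).
rewrite [RHS]integral_mkcond; apply: eq_integral => z _.
rewrite !patchE; have [Dz|nDz] := pselect (D z).
  by rewrite !mem_set//; exact: dilation_in_ball.
rewrite (memNset nDz) kern_eq0 ?mulr0//.
by move: nDz => /negP; rewrite -leNgt.
Qed.

Lemma kern_mean_nonincreasing r s : 0 <= r -> r <= s -> s < r2 ->
  (kern_mean u T w y s <= kern_mean u T w y r)%E.
Proof.
move=> r0 rs sr2; rewrite !kern_meanE ?ger0_norm// ?(le_trans r0)//; last first.
  exact: le_lt_trans sr2.
by rewrite lee_fin; exact: U_nonincreasing.
Qed.

Lemma kern_mean0 : kern_mean u T w y 0 = (u y * kern_mass n T w)%:E.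
Proof.
have By : unit_ball y.
  by apply: le_lt_trans yr2; rewrite lerDl mulr_ge0 ?sqrtr_ge0// ltW.
rewrite /kern_mean; under eq_integral do rewrite scale0r addr0 patchE mem_set// EFinM.
by rewrite integralZl//; [rewrite kern_massE|exact: integrable_kern].
Qed.

Lemma kern_mean_lower s : 0 <= s -> s < r2 ->
  ((u y * kern_mass n T w - A * cutoff_mass n T w * s ^+ 2 / 2)%:E <= kern_mean u T w y s)%E.
Proof.
move=> s0 sr2; have := kern_mean0; rewrite !kern_meanE ?normr0 ?ger0_norm// => -[<-].
by rewrite lee_fin lerBlDr; exact: U_lower.
Qed.

End dilation.
End supersolution.

(** * Comparison with a paraboloid *)

Section kernel_mass.
Context {R : realType} {n : nat}.
Implicit Types (y z : 'rV[R]_n).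

Lemma kernE (T w : R) z : kern T w z = kprof ((T - sqnorm z) / w).
Proof. by []. Qed.

Lemma kern_le (T w : R) z z' : 0 < w -> sqnorm z' <= sqnorm z -> kern T w z <= kern T w z'.
Proof.
by move=> w0 zz'; apply: kprof_nondecreasing; rewrite ler_pM2r ?invr_gt0// lerD2l lerN2.
Qed.

Lemma lebn_ball_gt0 (T : R) : 0 < T -> (0 < lebn n [set z : 'rV[R]_n | (sqnorm z < T)%R])%E.
Proof.
(* The cube of half-side a lies in the ball; n + 1 instead of n makes the inequality strict and
   covers n = 0. *)
move=> T0; pose a : R := Num.sqrt (T / n.+1%:R).
have a0 : 0 < a by rewrite sqrtr_gt0 divr_gt0.
have aa : - a <= a by lra.
apply: (@lt_le_trans _ _ ((a - - a) ^+ n)%:E).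
  by rewrite lte_fin exprn_gt0// opprK addr_gt0.
rewrite -lebn_box_itv//; apply: le_measure; rewrite ?inE.
- exact: measurable_box.
- exact: measurable_sqnorm_lt.
- move=> z /= za; rewrite /sqnorm.
  apply: (@le_lt_trans _ _ (\sum_(i < n) T / n.+1%:R)).
    apply: ler_sum => i _; have := za i; rewrite in_itv/= -ler_norml /Defs.coord => zi.
    rewrite -real_normK ?num_real// -[leRHS]sqr_sqrtr ?divr_ge0 ?(ltW T0)//.
    by rewrite ler_pXn2r// nnegrE ?normr_ge0 ?sqrtr_ge0.
  rewrite sumr_const card_ord -[_ *+ n]mulr_natr -mulrA gtr_pMr// mulrC ltr_pdivrMr// mul1r.
  by rewrite ltr_nat.
Qed.

Lemma integral_ge_ball (f : 'rV[R]_n -> R) (T c : R) x :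
  measurable_fun setT f -> (forall z, 0 <= f z) -> 0 <= c ->
  (forall z, sqnorm z < T -> c <= f (x + z)) ->
  (c%:E * lebn n [set z : 'rV[R]_n | (sqnorm z < T)%R] <= \int[lebn n]_z (f z)%:E)%E.
Proof.
move=> mf f0 c0 fc.
rewrite (ge0_integral_affine x 1)//; last exact/measurable_EFinP.
rewrite normr1 expr1n mul1e -integral_cst; last exact: measurable_sqnorm_lt.
have mfx : measurable_fun setT (fun z => (f (x + 1 *: z))%:E).
  apply/measurable_EFinP; exact: (measurableT_comp mf (measurable_affine_rV x 1)).
apply: (@le_trans _ _ (\int[lebn n]_(z in [set z | (sqnorm z < T)%R]) (f (x + 1 *: z))%:E)%E).
  apply: ge0_le_integral => //.
  - exact: measurable_sqnorm_lt.
  - exact: measurable_funTS.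
  - by move=> z /= zT; rewrite lee_fin scale1r fc.
by apply: ge0_subset_integral; [exact: measurable_sqnorm_lt|by []|exact: mfx|
  by move=> z _; rewrite lee_fin|by []].
Qed.

Lemma integral_gt0_ball (f : 'rV[R]_n -> R) (T c : R) x :
  measurable_fun setT f -> (forall z, 0 <= f z) -> 0 < T -> 0 < c ->
  (forall z, sqnorm z < T -> c <= f (x + z)) ->
  (0 < \int[lebn n]_z (f z)%:E)%E.
Proof.
move=> mf f0 T0 c0 fc; apply: lt_le_trans (integral_ge_ball f T c x mf f0 (ltW c0) fc).
by rewrite mule_gt0// lebn_ball_gt0.
Qed.

Lemma kern_mass_gt0 (T w : R) : 0 < T -> 0 < w -> 0 < kern_mass n T w.
Proof.
move=> T0 w0; rewrite -lte_fin -kern_massE//.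
apply: (integral_gt0_ball _ (T / 2) (kprof (T / 2 / w)) 0).
- by apply: continuous_measurable_rV; exact: continuous_kern.
- by move=> z; exact: kern_ge0.
- by rewrite divr_gt0.
- by rewrite kprof_gt0// !divr_gt0.
- move=> z zT; rewrite add0r kernE; apply: kprof_nondecreasing.
  by rewrite ler_pM2r ?invr_gt0//; lra.
Qed.

End kernel_mass.

Lemma measurable_restrict_ball {R : realType} {n : nat} (u : 'rV[R]_n -> R) :
  {within closed_unit_ball, continuous u} -> measurable_fun setT (u \_ unit_ball).
Proof.
move=> cu; apply/(measurable_restrictT _ measurable_unit_ball).
apply: open_continuous_measurable_rV => [|x /[!inE] Bx]; first exact: open_unit_ball.
exact: within_closed_ball_continuous.
Qed.

Section barrier.
Context {R : realType} {n : nat}.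
Implicit Types (y z : 'rV[R]_n).

Let J : R := \int[lebn n]_z (sqnorm z * kern 1 1 z).

Let integrable_sqnorm_kern : (lebn n).-integrable setT (EFin \o (fun z => sqnorm z * kern 1 1 z)).
Proof.
apply: (integrable_supported 1 1) => [|z z1|z].
- apply: measurable_funM; apply: continuous_measurable_rV.
    exact: continuous_sqnorm.
  exact: continuous_kern.
- by rewrite kern_eq0// mulr0.
- rewrite ger0_norm ?mulr_ge0 ?sqnorm_ge0 ?kern_ge0//.
  have [z1|z1] := leP 1 (sqnorm z); first by rewrite kern_eq0// mulr0.
  by rewrite -[leRHS]mulr1 ler_pM ?sqnorm_ge0 ?kern_ge0 ?kern_le1// ltW.
Qed.

(** The integrand is bounded below on the ball of radius 1/4 about a point at distance 1/2 from 0: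
    there 1/4 <= |z| <= 3/4, and 7/16 = 1 - (3/4)^2. *)
Let J_gt0 : (0 < n)%N -> 0 < J.
Proof.
move=> n0; rewrite -lte_fin /J fineK; last exact: integrable_fin_num integrable_sqnorm_kern.
pose x : 'rV[R]_n := 2^-1 *: delta_mx ord0 (Ordinal n0).
apply: (integral_gt0_ball _ (4^-1 ^+ 2) (4^-1 ^+ 2 * kprof (7 / 16)) x).
- apply: measurable_funM; apply: continuous_measurable_rV.
    exact: continuous_sqnorm.
  exact: continuous_kern.
- by move=> z; rewrite mulr_ge0 ?sqnorm_ge0 ?kern_ge0.
- by rewrite exprn_gt0// invr_gt0.
- by rewrite mulr_gt0// ?kprof_gt0 ?exprn_gt0 ?invr_gt0// divr_gt0.
have xE : enorm x = 2^-1.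
  rewrite enormZ ger0_norm ?invr_ge0// /enorm (bigD1 (Ordinal n0))//= mxE !eqxx expr1n.
  rewrite big1 ?addr0 ?sqrtr1 ?mulr1// => j ji.
  by rewrite mxE (negPf ji) andbF expr0n.
move=> z; rewrite -enorm_lt_sqnorm ?invr_ge0// => z4.
have h1 : enorm (x + z) <= 3 / 4.
  by rewrite (le_trans (enormD _ _))// xE; lra.
have h2 : 4^-1 <= enorm (x + z).
  have := enormB (x + z) z; rewrite addrK xE; lra.
apply: ler_pM.
- by rewrite exprn_ge0// invr_ge0.
- by rewrite ltW// kprof_gt0// divr_gt0.
- by rewrite -sqr_enorm ler_pXn2r// nnegrE ?invr_ge0 ?enorm_ge0.
- rewrite kernE; apply: kprof_nondecreasing; rewrite divr1.
  have : sqnorm (x + z) <= (3 / 4) ^+ 2 by rewrite -enorm_le_sqnorm.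
  by rewrite expr2; lra.
Qed.

Let dot_kern y z : R := (\sum_(i < n) y ord0 i * z ord0 i) * kern 1 1 z.

Let integrable_dot_kern y : (lebn n).-integrable setT (EFin \o dot_kern y).
Proof.
apply: (integrable_supported 1 (enorm y)) => [|z z1|z].
- apply: continuous_measurable_rV; apply: elementary_continuous.
  apply: elementaryM; last exact: elementary_kern.
  apply: elementary_sum => i; apply: elementaryM; first exact: elementary_cst.
  exact: elementary_coord.
- by rewrite /dot_kern kern_eq0// mulr0.
- have [z1|z1] := leP 1 (sqnorm z); first by rewrite /dot_kern kern_eq0// mulr0 normr0 enorm_ge0.
  rewrite normrM [`|kern _ _ _|]ger0_norm ?kern_ge0// -[leRHS]mulr1.
  apply: ler_pM; rewrite ?kern_ge0 ?kern_le1//.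
  have ez1 : enorm z <= 1 by rewrite enorm_le_sqnorm// expr1n ltW.
  by rewrite (le_trans (normr_sum_le_enorm y z))// ler_piMr ?enorm_ge0.
Qed.

(** The integrand is odd, so the reflection z -> -z identifies its integral with the opposite
    one. *)
Let dot_kern0 y : \int[lebn n]_z dot_kern y z = 0.
Proof.
have E : (\int[lebn n]_z (dot_kern y z)%:E = - \int[lebn n]_z (dot_kern y z)%:E)%E.
  have m1 : (-1 : R) != 0 by rewrite oppr_eq0 oner_eq0.
  rewrite [LHS](integral_affine 0 (-1) _ m1 (integrable_dot_kern y)).
  rewrite normrN1 expr1n mul1e -integralN; last first.
    have := integrable_neg_fin_num measurableT (integrable_dot_kern y).
    by move=> fn; apply: fin_num_adde_defl; rewrite fin_numN.
  apply: eq_integral => z _; rewrite -EFinN /dot_kern; congr EFin.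
  rewrite add0r scaleN1r /kern /kernel_arg sqnormN -/(kernel_arg _ _ _) -/(kern _ _ _).
  rewrite -mulNr -sumrN; congr (_ * _).
  by apply: eq_bigr => i _; rewrite mxE mulrN.
have /fineK F := integrable_fin_num measurableT (integrable_dot_kern y).
move: E; rewrite -F -EFinN => -[].
rewrite -/(\int[lebn n]_z dot_kern y z).
by move=> /eqP; rewrite -addr_eq0 => /eqP; lra.
Qed.

(* Otherwise u + C A |x|^2 has an interior maximum y; the mean of u over the
   kernel of radius s about y is then too small by a multiple of C A s^2, whereas
   kern_mean_lower only allows a loss of A c s^2 / 2. *)
Lemma supersolution_le_paraboloid : (0 < n)%N -> exists2 C : R, 0 < C &
  forall A u g, supersolution A u g -> 0 < A ->
  (forall x : 'rV[R]_n, unit_ball x -> 0 <= u x) ->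
  (forall x : 'rV[R]_n, unit_sphere x -> u x = 0) ->
  forall x, closed_unit_ball x -> u x <= C * A * (1 - sqnorm x).
Proof.
move=> n0; have J0 := J_gt0 n0.
pose c := cutoff_mass n (1 : R) 1.
have c0 : 0 <= c by exact: cutoff_mass_ge0.
(* Chosen so that C J exceeds c / 2, the coefficient of the loss in [kern_mean_lower]. *)
pose C := (c / 2 + 1) / J.
have C0 : 0 < C by rewrite divr_gt0// ltr_wpDl// divr_ge0.
have CJ : c / 2 < C * J by rewrite divfK ?gt_eqF// ltrDl.
exists C => // A u g ss A0 u_ge0 u0 x Bx.
pose v x := u x + C * A * sqnorm x.
have CA0 : 0 < C * A by rewrite mulr_gt0.
have cv : {within closed_unit_ball, continuous v}.
  move=> z; apply: (@continuousD _ _ _ (u : subspace closed_unit_ball -> R)).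
    exact: (ss_continuous _ _ _ ss).
  apply: continuous_subspaceT => {}z.
  by apply: (@continuousM _ _ (cst (C * A)) sqnorm); [exact: cst_continuous|exact: continuous_sqnorm].
have [|y /[!inE] By yP] :=
  @compact_EVT_max _ R v (@closed_unit_ball R n) _ (compact_closed_ball 1) cv.
  by exists 0; rewrite /closed_unit_ball/= enorm0.
suff : v y <= C * A by have := yP x (mem_set Bx); rewrite /v; lra.
have := By; rewrite /closed_unit_ball/= le_eqVlt => /predU1P[y1|y1].
  by rewrite /v u0// add0r -sqr_enorm y1 expr1n mulr1.
exfalso.
(* Even 2 s stays below the distance from y to the sphere, which provides the slack radius of
   [kern_mean_lower]. *)
pose s := (1 - enorm y) / 4.
have s0 : 0 < s by rewrite divr_gt0// subr_gt0.
have ys : enorm y + 2 * s * Num.sqrt 1 < 1 by rewrite sqrtr1 /s; lra.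
have s20 : 0 < 2 * s by rewrite mulr_gt0.
have ss2 : s < 2 * s by lra.
have lo := kern_mean_lower A u g ss 1 1 ltr01 ltr01 y (2 * s) s20 ys s (ltW s0) ss2.
pose I := kern_mass n (1 : R) 1.
(* Maximality of v at y bounds u (y + s z) by v y - C A |y + s z|^2. G is this bound times the
   kernel, expanded in s: the linear term integrates to 0 and the quadratic one yields J. *)
pose G z := u y * kern 1 1 z + (- (2 * C * A * s)) * dot_kern y z +
  (- (C * A * s ^+ 2)) * (sqnorm z * kern 1 1 z).
have GE z : G z = (v y - C * A * sqnorm (y + s *: z)) * kern 1 1 z.
  rewrite /G /v sqnormD sqnormZ /dot_kern.
  have -> : \sum_(i < n) y ord0 i * (s *: z) ord0 i = s * \sum_(i < n) y ord0 i * z ord0 i.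
    by rewrite mulr_sumr; apply: eq_bigr => i _; rewrite mxE mulrCA.
  by ring.
have i1 : (lebn n).-integrable setT (EFin \o (fun z => u y * kern 1 1 z)).
  exact: (integrableZl measurableT (u y) (integrable_kern 1 1 ltr01)).
have i2 : (lebn n).-integrable setT (EFin \o (fun z => - (2 * C * A * s) * dot_kern y z)).
  exact: (integrableZl measurableT _ (integrable_dot_kern y)).
have i3 : (lebn n).-integrable setT
    (EFin \o (fun z => - (C * A * s ^+ 2) * (sqnorm z * kern 1 1 z))).
  exact: (integrableZl measurableT _ integrable_sqnorm_kern).
have i12 : (lebn n).-integrable setT
    (EFin \o (fun z => u y * kern 1 1 z + - (2 * C * A * s) * dot_kern y z)).
  exact: (integrableD measurableT i1 i2).
have iG : (lebn n).-integrable setT (EFin \o G) by exact: (integrableD measurableT i12 i3).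
have IG : \int[lebn n]_z G z = u y * I - C * A * s ^+ 2 * J.
  rewrite (RintegralD measurableT i12 i3) (RintegralD measurableT i1 i2).
  rewrite !RintegralZl//; [|exact: integrable_kern].
  by rewrite dot_kern0 mulr0 addr0 mulNr.
have mu0 := measurable_restrict_ball u (ss_continuous _ _ _ ss).
have uvz z : closed_unit_ball z -> u z <= v y - C * A * sqnorm z.
  by move=> Bz; have := yP z (mem_set Bz); rewrite /v; lra.
have hi : (kern_mean u 1 1 y s <= (u y * I - C * A * s ^+ 2 * J)%:E)%E.
  rewrite -IG /Rintegral fineK; last exact: integrable_fin_num.
  have uG z : 0 <= (u \_ unit_ball) (y + s *: z) * kern 1 1 z <= G z.
    rewrite GE patchE; have [z1|z1] := leP 1 (sqnorm z); first by rewrite kern_eq0// !mulr0 lexx.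
    have Bz : unit_ball (y + s *: z).
      by apply: (dilation_in_ball 1 ltr01 y (2 * s) ys); rewrite ?gtr0_norm.
    rewrite mem_set// mulr_ge0 ?kern_ge0 ?u_ge0//= ler_wpM2r ?kern_ge0//.
    by apply: uvz; exact: ltW.
  apply: ge0_le_integral => //.
  - by move=> z _; rewrite lee_fin; have /andP[] := uG z.
  - apply/measurable_EFinP; apply: measurable_funM.
      exact: (measurableT_comp mu0 (measurable_affine_rV y s)).
    by apply: continuous_measurable_rV; exact: continuous_kern.
  - exact: measurable_int iG.
  - by move=> z _; rewrite lee_fin; have /andP[] := uG z.
have := le_trans lo hi; rewrite lee_fin -/I -/c.
suff : A * c * s ^+ 2 / 2 < C * A * s ^+ 2 * J by lra.
have As0 : 0 < A * s ^+ 2 by rewrite mulr_gt0// exprn_gt0.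
by have := CJ; rewrite -(ltr_pM2l As0); lra.
Qed.

End barrier.

(** * Lower bounds for means and for values *)

(** Not normalised by the volume. Scaling the argument instead of the domain allows s = 0; the value
    is an extended real, its finiteness being proved only when needed. *)
Definition ball_mean {R : realType} {n : nat} (u : 'rV[R]_n -> R) (s : R) : \bar R :=
  (\int[lebn n]_(z in [set z | (sqnorm z < 1)%R]) ((u \_ unit_ball) (s *: z))%:E)%E.

Lemma bernoulli_ineq {R : realType} (r : R) (n : nat) : 0 <= r <= 1 ->
  1 - r ^+ n <= n%:R * (1 - r).
Proof.
move=> /andP[r0 r1]; elim: n => [|n IH]; first by rewrite expr0 subrr mul0r.
rewrite exprS -natr1; have : r * (1 - r ^+ n) <= n%:R * (1 - r).
  by apply: le_trans IH; rewrite ler_piMl// subr_ge0 exprn_ile1.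
by lra.
Qed.

Section concentration.
Context {R : realType} {n : nat}.
Variables (A : R) (u : 'rV[R]_n -> R) (g : 'I_n -> 'rV[R]_n -> R).
Hypotheses (ss : supersolution A u g) (u_ge0 : forall x, unit_ball x -> 0 <= u x).
Implicit Types (x y z : 'rV[R]_n).

Lemma restrict_ball_ge0 x : 0 <= (u \_ unit_ball) x.
Proof. by rewrite patchE; case: ifPn => // /set_mem /u_ge0. Qed.

Let mu := measurable_restrict_ball u (ss_continuous _ _ _ ss).

Lemma measurable_restrict_kern (T w : R) y (r : R) y' (r' : R) :
  measurable_fun setT (fun z => ((u \_ unit_ball) (y + r *: z) * kern T w (y' + r' *: z))%:E).
Proof.
apply/measurable_EFinP; apply: measurable_funM.
  exact: (measurableT_comp mu (measurable_affine_rV y r)).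
have mk : measurable_fun setT (kern T w : 'rV[R]_n -> R).
  by apply: continuous_measurable_rV; exact: continuous_kern.
exact: (measurableT_comp mk (measurable_affine_rV y' r')).
Qed.

Lemma kern_mean_ge0 (T w : R) y (r : R) : (0 <= kern_mean u T w y r)%E.
Proof.
apply: integral_ge0 => z _.
by rewrite lee_fin mulr_ge0 ?restrict_ball_ge0 ?kern_ge0.
Qed.

Lemma measurable_restrict_kern_rescaled (T w : R) y (r : R) :
  measurable_fun setT (fun x => ((u \_ unit_ball) x * kern T w (r^-1 *: (x - y)))%:E).
Proof.
rewrite (_ : (fun _ => _) = (fun z => ((u \_ unit_ball) (0 + 1 *: z) *
    kern T w (- (r^-1 *: y) + r^-1 *: z))%:E)).
  exact: measurable_restrict_kern.
by apply/funext => z; rewrite add0r scale1r scalerBr addrC.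
Qed.

(** Turns means with different centres and radii into integrals in one variable x, where their
    kernels can be compared pointwise. *)
Lemma kern_mean_rescale (T w : R) y (r : R) : 0 < r ->
  ((r ^+ n)%:E * kern_mean u T w y r =
   \int[lebn n]_x ((u \_ unit_ball) x * kern T w (r^-1 *: (x - y)))%:E)%E.
Proof.
move=> r0; have rn : r != 0 by rewrite gt_eqF.
rewrite (ge0_integral_affine y r _ rn (measurable_restrict_kern_rescaled T w y r)); last first.
  by move=> x; rewrite lee_fin mulr_ge0 ?restrict_ball_ge0 ?kern_ge0.
rewrite (gtr0_norm r0); congr (_ * _)%E; apply: eq_integral => z _.
by rewrite (affine_rVKV y r z rn).
Qed.

Lemma kern_mean_le_ball_mean (T w s : R) : 0 < w -> T <= 1 ->
  (kern_mean u T w 0 s <= ball_mean u s)%E.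
Proof.
move=> w0 T1; rewrite /ball_mean [leRHS]integral_mkcond.
apply: ge0_le_integral => //.
- by move=> z _; rewrite lee_fin mulr_ge0 ?restrict_ball_ge0 ?kern_ge0.
- have := measurable_restrict_kern T w 0 s 0 1; congr measurable_fun.
  by apply/funext => z; rewrite [in kern _ _ _]add0r scale1r.
- apply/(measurable_restrictT _ (measurable_sqnorm_lt 1)).
  apply: measurable_funTS; apply/measurable_EFinP.
  have := measurableT_comp mu (measurable_affine_rV 0 s); congr measurable_fun.
  by apply/funext => z; rewrite /= add0r.
- move=> z _; rewrite add0r [leRHS]patchE; have [z1|z1] := ltP (sqnorm z) 1.
    by rewrite mem_set// lee_fin ler_piMr ?restrict_ball_ge0 ?kern_le1.
  rewrite memNset; last by rewrite /= ltNge z1.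
  by rewrite kern_eq0 ?mulr0// (le_trans T1).
Qed.

(** The last hypothesis makes the loss in [kern_mean_lower] at most half of the value at radius
    0. *)
Lemma kern_mean_center_lower x0 (k : R) : 0 < k -> enorm x0 + 2 * k < 1 ->
  A * cutoff_mass n 1 1 * k ^+ 2 <= u x0 * kern_mass n 1 1 ->
  ((u x0 * kern_mass n 1 1 / 2)%:E <= kern_mean u 1 1 x0 k)%E.
Proof.
move=> k0 xk h.
have k20 : 0 < 2 * k by rewrite mulr_gt0.
have kk2 : k < 2 * k by lra.
have xk' : enorm x0 + 2 * k * Num.sqrt 1 < 1 by rewrite sqrtr1 mulr1.
apply: le_trans (kern_mean_lower A u g ss 1 1 ltr01 ltr01 x0 (2 * k) k20 xk' k (ltW k0) kk2).
by rewrite lee_fin; lra.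
Qed.

(** Away from the sphere one kernel at the origin dominates the kernel about x0. All of k^n is lost,
    which is affordable because k may then be of order sqrt (u x0 / A). *)
Lemma ball_mean_ge_interior x0 (k s : R) : 0 < k -> enorm x0 + k <= 3 / 4 ->
  0 <= s <= 2^-1 ->
  ((kprof (11 / 36) * k ^+ n)%:E * kern_mean u 1 1 x0 k <= ball_mean u s)%E.
Proof.
(* For |x| <= 3/4 the kernel of radius 9/10 has argument at least 1 - (9/16)(100/81) = 11/36. *)
move=> k0 xk /andP[s0 s2]; pose r : R := 9 / 10.
have r0 : 0 < r by rewrite divr_gt0.
have m0 : 0 < kprof (11 / 36 : R) by rewrite kprof_gt0// divr_gt0.
have r2 : enorm (0 : 'rV[R]_n) + (19 / 20) * Num.sqrt 1 < 1 by rewrite enorm0 sqrtr1; lra.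
have sr : s <= r by rewrite /r; lra.
have rr2 : r < 19 / 20 by rewrite /r; lra.
apply: le_trans (kern_mean_le_ball_mean 1 1 s ltr01 (lexx _)).
apply: le_trans (kern_mean_nonincreasing A u g ss 1 1 ltr01 ltr01 0 (19 / 20) r2 s r s0 sr rr2).
apply: (@le_trans _ _ ((r ^+ n)%:E * kern_mean u 1 1 0 r)%E); last first.
  rewrite -[leRHS]mul1e lee_wpmul2r ?kern_mean_ge0// lee_fin exprn_ile1 ?(ltW r0)//.
  by rewrite /r; lra.
have mresc := measurable_restrict_kern_rescaled.
rewrite EFinM -muleA !kern_mean_rescale//.
rewrite -ge0_integralZl//; last 2 first.
- by move=> z _; rewrite lee_fin mulr_ge0 ?restrict_ball_ge0 ?kern_ge0.
- by rewrite lee_fin ltW.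
apply: ge0_le_integral => //.
- by move=> z _; rewrite -EFinM lee_fin !mulr_ge0 ?restrict_ball_ge0 ?kern_ge0// ltW.
- by apply: measurable_funeM.
move=> x _; rewrite -EFinM lee_fin mulrCA ler_wpM2l ?restrict_ball_ge0//.
have [x1|x1] := leP 1 (sqnorm (k^-1 *: (x - x0))).
  by rewrite [kern _ _ (k^-1 *: _)]kern_eq0// mulr0 kern_ge0.
apply: (@le_trans _ _ (kprof (11 / 36))).
  by rewrite ler_piMr ?(ltW m0)// kern_le1.
rewrite kernE; apply: kprof_nondecreasing; rewrite divr1 subr0.
have xk1 : enorm (x - x0) < k.
  have : enorm (k^-1 *: (x - x0)) < 1 by rewrite enorm_lt_sqnorm// expr1n.
  by rewrite enormZ gtr0_norm ?invr_gt0// ltr_pdivrMl// mulr1.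
have xx : enorm x <= 3 / 4.
  rewrite -(subrK x0 x) addrC (le_trans (enormD _ _))//.
  by lra.
rewrite sqnormZ; have : sqnorm x <= (3 / 4) ^+ 2 by rewrite -enorm_le_sqnorm// divr_ge0.
have -> : r^-1 ^+ 2 = 100 / 81 by rewrite /r; field.
by rewrite expr2; lra.
Qed.

(* With K = kern T w and Psi r = kern_mean u T w 0 r, the difference
   K x - K (x / r) is nonnegative and bounded below by a constant on the ball
   of radius k about x0, so that k^n times the mean about x0 is at most a
   constant times Psi 1 - r^n Psi r <= (1 - r^n) Psi r.  As 1 - r is of order k,
   only the factor k^(n-1) is lost. *)
Lemma ball_mean_ge_shell x0 (k s : R) : (0 < n)%N -> 2^-1 <= enorm x0 ->
  0 < k -> k <= 24^-1 -> 12 * k <= 1 - sqnorm x0 -> 0 <= s <= 2^-1 ->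
  ((expR (- 4) * (2 / 3) ^+ 3 / 4 / (6 * n%:R) * k ^+ n.-1)%:E * kern_mean u 1 1 x0 k
     <= ball_mean u s)%E.
Proof.
move=> n0 x02 k0 k24 kx0 /andP[s0 s2].
have q0 : 0 < expR (- 4) * (2 / 3) ^+ 3 / 4 :> R.
  by rewrite divr_gt0// mulr_gt0 ?expR_gt0// exprn_gt0// divr_gt0.
have gap := @kprof_gap R.
set q : R := expR (- 4) * (2 / 3) ^+ 3 / 4 in q0 gap *; clearbody q.
(* On the ball of radius k about x0, |x|^2 varies by at most 3k, so w = 6k places (T - |x|^2) / w in
   [1/2, 3/2], as [kprof_gap] requires; 12 k <= 1 - |x0|^2 keeps T below 1. *)
pose w := 6 * k; pose T := sqnorm x0 + w; pose r := 1 - w.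
have w0 : 0 < w by rewrite mulr_gt0.
have w4 : w <= 4^-1 by rewrite /w; lra.
have T1 : T < 1 by rewrite /T /w; lra.
have T0 : 0 < T by rewrite ltr_wpDl ?sqnorm_ge0.
have r0 : 0 < r by rewrite /r; lra.
have r1 : r <= 1 by rewrite /r; lra.
have sr : s <= r by rewrite /r; lra.
have sT1 : Num.sqrt T < 1 by rewrite -sqrtr1 ltr_sqrt.
have sT0 : 0 < Num.sqrt T by rewrite sqrtr_gt0.
(* The reciprocal of the midpoint of sqrt T and 1: it exceeds 1 while r2 sqrt T < 1. *)
pose r2 : R := 2 / (1 + Num.sqrt T).
have r21 : 1 < r2 by rewrite /r2 ltr_pdivlMr ?addr_gt0//; lra.
have r20 : 0 < r2 by lra.
have yr2 : enorm (0 : 'rV[R]_n) + r2 * Num.sqrt T < 1.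
  by rewrite enorm0 add0r /r2 mulrAC ltr_pdivrMr ?addr_gt0//; lra.
have nonincr := kern_mean_nonincreasing A u g ss T w T0 w0 0 r2 yr2.
apply: le_trans (kern_mean_le_ball_mean T w s w0 (ltW T1)).
apply: le_trans (nonincr s r s0 sr (le_lt_trans r1 r21)).
have a1r := nonincr r 1 (ltW r0) r1 r21.
(* Both means are bounded by those at radius 0, hence finite, so that [main] can be rearranged in
   R. *)
have fin0 : kern_mean u T w 0 r \is a fin_num.
  rewrite ge0_fin_numE ?kern_mean_ge0//.
  apply: le_lt_trans (nonincr 0 r (lexx _) (ltW r0) (le_lt_trans r1 r21)) _.
  by rewrite (kern_mean0 u T w w0 0 r2 r20 yr2) ltry.
have fink : kern_mean u 1 1 x0 k \is a fin_num.
  rewrite ge0_fin_numE ?kern_mean_ge0//.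
  have x0k : enorm x0 + 2 * k * Num.sqrt 1 < 1.
    have := sqr_enorm x0; rewrite sqrtr1 expr2; have := enorm_ge0 x0; nra.
  have k20 : 0 < 2 * k by lra.
  have kk2 : k < 2 * k by lra.
  apply: le_lt_trans (kern_mean_nonincreasing A u g ss 1 1 ltr01 ltr01
    x0 (2 * k) x0k 0 k (lexx _) (ltW k0) kk2) _.
  by rewrite (kern_mean0 u 1 1 ltr01 x0 (2 * k) k20 x0k) ltry.
have main : ((r ^+ n)%:E * kern_mean u T w 0 r + q%:E * ((k ^+ n)%:E * kern_mean u 1 1 x0 k) <=
    kern_mean u T w 0 1)%E.
  have E1 : kern_mean u T w 0 1 = ((1 ^+ n)%:E * kern_mean u T w 0 1)%E by rewrite expr1n mul1e.
  have mresc := measurable_restrict_kern_rescaled.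
  rewrite E1 (kern_mean_rescale T w 0 1 ltr01) (kern_mean_rescale T w 0 r r0).
  rewrite (kern_mean_rescale 1 1 x0 k k0).
  rewrite -ge0_integralZl; last 4 first.
  - exact: measurableT.
  - exact: mresc.
  - by move=> z _; rewrite lee_fin mulr_ge0 ?restrict_ball_ge0 ?kern_ge0.
  - by rewrite lee_fin ltW.
  rewrite -ge0_integralD; last 5 first.
  - exact: measurableT.
  - by move=> z _; rewrite lee_fin mulr_ge0 ?restrict_ball_ge0 ?kern_ge0.
  - exact: mresc.
  - by move=> z _; rewrite -EFinM lee_fin !mulr_ge0 ?restrict_ball_ge0 ?kern_ge0// ltW.
  - by apply: measurable_funeM; exact: mresc.
  apply: ge0_le_integral => //.
  - move=> z _; rewrite -EFinM -EFinD lee_fin.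
    by rewrite addr_ge0 ?mulr_ge0 ?restrict_ball_ge0 ?kern_ge0// ltW.
  - by apply: emeasurable_funD => //; apply: measurable_funeM.
  move=> x _; rewrite -EFinM -EFinD lee_fin mulrCA -mulrDr.
  rewrite ler_wpM2l ?restrict_ball_ge0// invr1 scale1r subr0.
  have kr : sqnorm x <= sqnorm (r^-1 *: x).
    by rewrite sqnormZ ler_peMl ?sqnorm_ge0// exprn_ege1// invf_ge1.
  have [x1|x1] := leP 1 (sqnorm (k^-1 *: (x - x0))).
    by rewrite [kern _ _ (k^-1 *: _)]kern_eq0// mulr0 addr0 kern_le.
  have xe : `|sqnorm x - sqnorm x0| <= 3 * k.
    pose z := k^-1 *: (x - x0).
    have -> : x = x0 + k *: z by rewrite /z affine_rVK ?gt_eqF.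
    have z1 : enorm z <= 1 by rewrite enorm_le_sqnorm// expr1n ltW.
    have x01 : enorm x0 <= 1.
      rewrite enorm_le_sqnorm// expr1n; lra.
    have zx : enorm x0 * enorm z <= 1 by rewrite mulr_ile1 ?enorm_ge0.
    have zz : 0 <= sqnorm z <= 1 by rewrite sqnorm_ge0/= ltW.
    clearbody z; rewrite sqnormD sqnormZ.
    have -> : \sum_(i < n) x0 ord0 i * (k *: z) ord0 i = k * \sum_(i < n) x0 ord0 i * z ord0 i.
      by rewrite mulr_sumr; apply: eq_bigr => i _; rewrite mxE mulrCA.
    have := le_trans (normr_sum_le_enorm x0 z) zx; set S := \sum_(_ < _) _.
    rewrite ler_norml => /andP[S1 S2].
    rewrite ler_norml; apply/andP; split; nra.
  have xT : 8^-1 <= sqnorm x.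
    have : 4^-1 <= sqnorm x0 by rewrite -sqr_enorm expr2; nra.
    by move: xe; rewrite ler_norml => /andP[]; lra.
  move: xe; rewrite ler_norml => /andP[xe1 xe2].
  rewrite -lerBrDl; apply: (@le_trans _ _ q).
    by rewrite ler_piMr ?(ltW q0)// kern_le1.
  rewrite !kernE; apply: gap.
  - by rewrite ler_pdivlMr// /T /w; lra.
  - by rewrite ler_pdivrMr// /T /w; lra.
  (* Dividing x by r multiplies |x|^2 by at least 1 + 2 w; as |x|^2 >= 1/8, the kernel argument
     drops by at least 1/4. *)
  - rewrite ler_pdivrMr// mulrBl divfK ?gt_eqF// sqnormZ.
    have : 1 + 2 * w <= r^-1 ^+ 2.
      rewrite exprVn -[leRHS]mul1r ler_pdivlMr ?exprn_gt0// /r expr2; nra.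
    move=> /(ler_wpM2r (sqnorm_ge0 x)).
    have : w * 8^-1 <= w * sqnorm x by rewrite ler_wpM2l// ltW.
    lra.
have [a aE] : exists a : R, kern_mean u T w 0 r = a%:E.
  by eexists; exact: esym (fineK fin0).
have [b bE] : exists b : R, kern_mean u 1 1 x0 k = b%:E.
  by eexists; exact: esym (fineK fink).
have a0 : 0 <= a by rewrite -lee_fin -aE kern_mean_ge0.
move: (le_trans main a1r); rewrite aE bE -!EFinM -EFinD !lee_fin => h.
have rn : 1 - r ^+ n <= n%:R * w.
  by rewrite (le_trans (bernoulli_ineq r n _))// ?(ltW r0)//= /r; lra.
have h2 : q * (k ^+ n * b) <= n%:R * w * a.
  by have := ler_wpM2r a0 rn; lra.
have n0' : 0 < n%:R :> R by rewrite ltr0n.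
(* The factor w = 6 k from 1 - r^n <= n w cancels one power in k^n. *)
have E : q / (6 * n%:R) * k ^+ n.-1 * b = q * (k ^+ n * b) / (n%:R * w).
  have kE : k ^+ n = k * k ^+ n.-1 by rewrite -exprS prednK.
  rewrite kE /w; field.
  by rewrite !gt_eqF.
by rewrite E ler_pdivrMr ?mulr_gt0// [leRHS]mulrC.
Qed.

End concentration.

Section lower_bounds.
Context {R : realType} {n : nat}.

Let I : R := kern_mass n 1 1.
Let I0 : 0 < I. Proof. exact: kern_mass_gt0. Qed.
Let cm : R := cutoff_mass n 1 1.
Let cm0 : 0 <= cm. Proof. exact: cutoff_mass_ge0. Qed.

(** Two regimes. If |x0| >= 1/2, the distance to the sphere limits k to the order of t = u x0 / A,
    and the shell estimate applies. If |x0| < 1/2, only [kern_mean_center_lower] matters, so k^2 is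
    of order t. *)
Lemma ball_mean_lower (C : R) : (1 < n)%N -> 0 < C -> exists2 c : R, 0 < c &
  forall A (u : 'rV[R]_n -> R) g, supersolution A u g -> 0 < A ->
  (forall x, unit_ball x -> 0 <= u x) ->
  forall x0 s, 0 < u x0 -> u x0 <= C * A * (1 - sqnorm x0) -> 0 <= s <= 2^-1 ->
  ((c * (u x0 * (u x0 / A) ^+ n.-1))%:E <= ball_mean u s)%E.
Proof.
move=> n1 C0; have n0 := ltnW n1.
pose q : R := expR (- 4) * (2 / 3) ^+ 3 / 4 / (6 * n%:R).
have q0 : 0 < q.
  by rewrite divr_gt0 ?mulr_gt0 ?ltr0n// divr_gt0// mulr_gt0 ?expR_gt0// exprn_gt0// divr_gt0.
pose p : R := kprof (11 / 36).
have p0 : 0 < p by rewrite kprof_gt0// divr_gt0.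
(* One constant for two demands: k (a C) <= 1 keeps the ball about x0 inside the unit ball, and a cm
   <= I serves [kern_mean_center_lower]. *)
pose a (k : R) := (k * C + cm / I)^-1.
have a_gt0 k : 0 < k -> 0 < a k.
  by move=> k0; rewrite invr_gt0 ltr_wpDr ?divr_ge0 ?(ltW I0)// mulr_gt0.
have aC k : 0 < k -> k * (a k * C) <= 1.
  move=> k0; have := a_gt0 k k0; rewrite /a invr_gt0 => k1.
  by rewrite mulrCA mulrC ler_pdivrMr// mul1r lerDl divr_ge0// ltW.
have acm k : 0 < k -> a k * cm <= I.
  move=> k0; have := a_gt0 k k0; rewrite /a invr_gt0 => k1.
  rewrite mulrC ler_pdivrMr// mulrDr [I * (cm / I)]mulrC divfK ?gt_eqF// lerDr.
  by rewrite !mulr_ge0// ltW.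
exists (Num.min (q * a 24 ^+ n.-1 * (I / 2)) (p * a 64 ^+ n.-1 * (I / 2))).
  have I2 : 0 < I / 2 by rewrite divr_gt0.
  by rewrite lt_min; apply/andP; split; apply: mulr_gt0 => //; apply: mulr_gt0 => //;
    rewrite exprn_gt0// a_gt0.
move=> A u g ss A0 u_ge0 x0 s M0 MC s02.
set M := u x0 in M0 MC *; pose t := M / A.
have t0 : 0 < t by rewrite divr_gt0.
have At : A * t = M by rewrite /t mulrC divfK ?gt_eqF.
have tC : t <= C * (1 - sqnorm x0).
  by rewrite /t ler_pdivrMr// mulrAC.
have tC' : t <= C.
  by rewrite (le_trans tC)// ler_piMr ?(ltW C0)// gerBl sqnorm_ge0.
have Mt0 : 0 <= M * t ^+ n.-1 by rewrite mulr_ge0 ?exprn_ge0 ?ltW.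
have [x2|x2] := leP 2^-1 (enorm x0).
  pose k := a 24 * t.
  have k0 : 0 < k by rewrite mulr_gt0// a_gt0.
  have kC : 24 * k <= 1 - sqnorm x0.
    have B0 : 0 <= 1 - sqnorm x0.
      by rewrite -(pmulr_rge0 _ C0) (le_trans (ltW t0)).
    have := ler_wpM2r B0 (aC 24 ltac:(by [])); rewrite mul1r; apply: le_trans.
    by rewrite /k -mulrA ler_pM2l// -mulrA ler_pM2l// a_gt0.
  have sq0 := sqnorm_ge0 x0.
  have k24 : k <= 24^-1 by lra.
  have kC' : 12 * k <= 1 - sqnorm x0 by lra.
  have xk : enorm x0 + 2 * k < 1.
    have := sqr_enorm x0; rewrite expr2; have := enorm_ge0 x0; nra.
  have Acm : A * cm * k ^+ 2 <= M * I.
    have -> : A * cm * k ^+ 2 = M * (a 24 * cm) * k by rewrite -At /k; ring.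
    rewrite -[leRHS]mulr1 ler_pM//; last by lra.
    - by rewrite mulr_ge0 ?(ltW M0)// mulr_ge0// ltW// a_gt0.
    - exact: ltW.
    - by rewrite ler_pM2l// acm.
  have lo := kern_mean_center_lower A u g ss x0 k k0 xk Acm.
  apply: le_trans (ball_mean_ge_shell A u g ss u_ge0 x0 k s n0 x2 k0 k24 kC' s02).
  rewrite -/q; have qk : 0 <= q * k ^+ n.-1 by rewrite mulr_ge0 ?exprn_ge0 ?ltW.
  apply: le_trans (lee_wpmul2l _ lo); last by rewrite lee_fin.
  rewrite -EFinM lee_fin -/I -/M.
  have -> : q * k ^+ n.-1 * (M * I / 2) = q * a 24 ^+ n.-1 * (I / 2) * (M * t ^+ n.-1).
    by rewrite /k exprMn; ring.
  by rewrite ler_wpM2r// ge_min lexx.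
(* The value 64 gives k <= 1/8, hence |x0| + 2 k < 1 and |x0| + k <= 3/4. *)
pose k := Num.sqrt (a 64 * t).
have at0 : 0 < a 64 * t by rewrite mulr_gt0// a_gt0.
have k0 : 0 < k by rewrite sqrtr_gt0.
have k2 : k ^+ 2 = a 64 * t by rewrite sqr_sqrtr// ltW.
have k8 : k <= 8^-1.
  have h1 : a 64 * t <= a 64 * C by rewrite ler_pM2l// a_gt0.
  have h2 := aC 64 ltac:(by []).
  rewrite -(ler_pXn2r (n := 2))// ?nnegrE ?(ltW k0)// k2.
  have -> : 8^-1 ^+ 2 = 64^-1 :> R by field.
  lra.
have xk : enorm x0 + 2 * k < 1 by lra.
have xk' : enorm x0 + k <= 3 / 4 by lra.
have Acm : A * cm * k ^+ 2 <= M * I.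
  have -> : A * cm * k ^+ 2 = M * (a 64 * cm) by rewrite k2 -At; ring.
  by rewrite ler_pM2l// acm.
have lo := kern_mean_center_lower A u g ss x0 k k0 xk Acm.
apply: le_trans (ball_mean_ge_interior A u g ss u_ge0 x0 k s k0 xk' s02).
rewrite -/p; have pk : 0 <= p * k ^+ n by rewrite mulr_ge0 ?exprn_ge0 ?ltW.
apply: le_trans (lee_wpmul2l _ lo); last by rewrite lee_fin.
rewrite -EFinM lee_fin -/I -/M.
apply: (@le_trans _ _ (p * a 64 ^+ n.-1 * (I / 2) * (M * t ^+ n.-1))).
  by rewrite ler_wpM2r// ge_min lexx orbT.
have -> : p * a 64 ^+ n.-1 * (I / 2) * (M * t ^+ n.-1) = p * (a 64 * t) ^+ n.-1 * (M * I / 2).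
  by rewrite [(a 64 * t) ^+ _]exprMn; move: (a 64 ^+ _) (t ^+ _) => e1 e2; clearbody p; ring.
rewrite ler_wpM2r ?divr_ge0 ?mulr_ge0 ?(ltW M0) ?(ltW I0)//.
(* As k <= 1 and n <= 2 (n - 1), the power k^n is at least (k^2)^(n-1). *)
rewrite ler_wpM2l ?(ltW p0)// -k2 -exprM ler_wiXn2l ?(ltW k0)//; first by lra.
by case: (n) n1 => // m m0; rewrite mul2n -addnn -[m.+1]add1n leq_add2r.
Qed.

Let D : set 'rV[R]_n := [set z | sqnorm z < 1].

Let measurable_rescaled_indic (u : 'rV[R]_n -> R) (s : R) :
  {within closed_unit_ball, continuous u} ->
  measurable_fun setT (fun x => ((u \_ unit_ball) x * \1_D (s^-1 *: x))%:E).
Proof.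
move=> cu; apply/measurable_EFinP; apply: measurable_funM; first exact: measurable_restrict_ball.
rewrite (_ : (fun _ => _) = (\1_D : 'rV[R]_n -> R) \o (fun x => 0 + s^-1 *: x)).
  apply: measurableT_comp; last exact: measurable_affine_rV.
  by apply: measurable_indic; exact: measurable_sqnorm_lt.
by apply/funext => x; rewrite /= add0r.
Qed.

Let ball_mean_rescale (u : 'rV[R]_n -> R) (s : R) :
  {within closed_unit_ball, continuous u} -> (forall x, unit_ball x -> 0 <= u x) -> 0 < s ->
  ((s ^+ n)%:E * ball_mean u s =
   \int[lebn n]_x ((u \_ unit_ball) x * \1_D (s^-1 *: x))%:E)%E.
Proof.
move=> cu u_ge0 s0; have sn : s != 0 by rewrite gt_eqF.
have mF : measurable_fun setT (fun x => ((u \_ unit_ball) x * \1_D (s^-1 *: x))%:E).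
  exact: measurable_rescaled_indic.
rewrite (ge0_integral_affine 0 s _ sn mF); last first.
  by move=> x; rewrite lee_fin mulr_ge0 ?restrict_ball_ge0.
rewrite gtr0_norm//; congr (_ * _)%E; rewrite /ball_mean integral_mkcond.
apply: eq_integral => z _; rewrite add0r scalerA mulVf// scale1r.
rewrite patchE indicE; have [Dz|Dz] := boolP (z \in D); first by rewrite /= mulr1.
by rewrite /= mulr0.
Qed.

(* A lower bound on the ball of radius enorm y - sg propagates, up to the factor
   be, to the point y, since a fixed proportion of the mass of the kernel of
   radius R0 about y lies in that ball. *)
Lemma chain_lower (rho : R) : 0 <= rho < 1 -> exists s c : R,
  [/\ 0 <= s <= 2^-1, 0 < c & forall A (u : 'rV[R]_n -> R) g, supersolution A u g ->
  (forall x, unit_ball x -> 0 <= u x) ->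
  forall y, enorm y <= rho -> (c%:E * ball_mean u s <= (u y)%:E)%E].
Proof.
move=> /andP[rho0 rho1].
(* Kernels of radius R0, and even 3/2 R0, about points of norm at most rho stay inside the unit
   ball. *)
pose R0 := (1 - rho) / 2; pose s := R0 / 4; pose sg := R0 / 8.
have R00 : 0 < R0 by rewrite divr_gt0// subr_gt0.
have R02 : R0 <= 2^-1 by rewrite /R0; lra.
have s0 : 0 < s by rewrite divr_gt0.
have sg0 : 0 < sg by rewrite divr_gt0.
pose m : R := kprof (3 / 4).
have m0 : 0 < m by rewrite kprof_gt0// divr_gt0.
pose B : set 'rV[R]_n := [set z | sqnorm z < 8^-1 ^+ 2].
have B0 : (0 < lebn n B)%E by rewrite lebn_ball_gt0// exprn_gt0// invr_gt0.
have Bfin : lebn n B \is a fin_num.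
  by rewrite ge0_fin_numE ?measure_ge0//; exact: lebn_sqnorm_lt.
pose v := fine (lebn n B).
have v0 : 0 < v by rewrite fine_gt0// B0/= lebn_sqnorm_lt.
(* The minimum with 1 lets points that need fewer than N steps share the bound with be^N. *)
pose be := Num.min 1 (m * v / I).
have be0 : 0 < be by rewrite lt_min ltr01/= !mulr_gt0// invr_gt0.
pose c0 := m * 4^-1 ^+ n / I.
have c00 : 0 < c0 by rewrite divr_gt0// mulr_gt0// exprn_gt0// invr_gt0.
pose N := `|Num.trunc (rho / sg)|.+1%N.
have Nrho : rho <= N%:R * sg by rewrite -ler_pdivrMr// ltW// truncnS_gt.
exists s, (be ^+ N * c0); split.
- by rewrite (ltW s0)/= /s; lra.
- by rewrite mulr_gt0// exprn_gt0.
move=> A u g ss u_ge0.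
have mean y : enorm y <= rho -> (kern_mean u 1 1 y R0 <= (u y * I)%:E)%E.
  move=> yr.
  have yr2 : enorm y + (3 / 2 * R0) * Num.sqrt 1 < 1 by rewrite sqrtr1 /R0; lra.
  have r20 : 0 < 3 / 2 * R0 by lra.
  have R0r : R0 < 3 / 2 * R0 by lra.
  have := kern_mean_nonincreasing A u g ss 1 1 ltr01 ltr01 y _ yr2 0 R0 (lexx _) (ltW R00) R0r.
  by rewrite (kern_mean0 u 1 1 ltr01 y _ r20 yr2).
have mu0 := measurable_restrict_ball u (ss_continuous _ _ _ ss).
have bm0 : (0 <= ball_mean u s)%E.
  by apply: integral_ge0 => z _; rewrite lee_fin restrict_ball_ge0.
(* If |x| and |y| are at most R0 / 4, then |x - y| <= R0 / 2, where the kernel of radius R0 about y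
   is at least [kprof (3 / 4)]. *)
have base y : enorm y <= rho -> enorm y <= R0 / 4 -> (c0%:E * ball_mean u s <= (u y)%:E)%E.
  move=> yr yR.
  have H : ((m * s ^+ n)%:E * ball_mean u s <= (R0 ^+ n * (u y * I))%:E)%E.
    rewrite EFinM -muleA (ball_mean_rescale u s (ss_continuous _ _ _ ss) u_ge0 s0).
    apply: (@le_trans _ _ ((R0 ^+ n)%:E * kern_mean u 1 1 y R0)%E); last first.
      by rewrite EFinM lee_wpmul2l ?lee_fin ?exprn_ge0 ?(ltW R00)// mean.
    rewrite (kern_mean_rescale A u g ss u_ge0 1 1 y R0 R00).
    have mD : measurable_fun setT (fun x => ((u \_ unit_ball) x * \1_D (s^-1 *: x))%:E).
      exact: measurable_rescaled_indic (ss_continuous _ _ _ ss).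
    rewrite -ge0_integralZl; last 4 first.
    - exact: measurableT.
    - exact: mD.
    - by move=> x _; rewrite lee_fin mulr_ge0 ?restrict_ball_ge0.
    - by rewrite lee_fin ltW.
    apply: ge0_le_integral.
    - exact: measurableT.
    - by move=> x _; rewrite -EFinM lee_fin !mulr_ge0 ?restrict_ball_ge0 ?(ltW m0).
    - by apply: measurable_funeM.
    - exact: (measurable_restrict_kern_rescaled A u g ss).
    - move=> x _; rewrite -EFinM lee_fin mulrCA ler_wpM2l ?restrict_ball_ge0//.
      rewrite indicE; have [/set_mem Dx|_] := boolP (_ \in D); last by rewrite mulr0 kern_ge0.
      rewrite mulr1 kernE; apply: kprof_nondecreasing; rewrite divr1.
      have xs : enorm x <= s.
        have : enorm (s^-1 *: x) <= 1 by rewrite enorm_le_sqnorm// expr1n ltW.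
        by rewrite enormZ gtr0_norm ?invr_gt0// ler_pdivrMl// mulr1.
      have : enorm (R0^-1 *: (x - y)) <= 2^-1.
        rewrite enormZ gtr0_norm ?invr_gt0// ler_pdivrMl//.
        by rewrite (le_trans (enormB _ _))//; move: xs; rewrite /s; lra.
      by rewrite enorm_le_sqnorm ?invr_ge0// expr2; lra.
  move: bm0 H; case: (ball_mean u s) => [b _ | _|]//.
    rewrite -!EFinM !lee_fin /c0 /s exprMn => H.
    rewrite mulrAC ler_pdivrMr// -(ler_pM2l (exprn_gt0 n R00)).
    by apply: le_trans H; rewrite le_eqVlt; apply/orP; left; apply/eqP; ring.
  by rewrite gt0_muley ?lte_fin ?mulr_gt0 ?exprn_gt0// leye_eq.
have step y ga : enorm y <= rho -> R0 / 4 < enorm y -> 0 <= ga ->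
    (forall x, enorm x <= enorm y - sg -> ga <= u x) -> be * ga <= u y.
  move=> yr yR ga0 uga.
  have y0 : 0 < enorm y by apply: lt_trans yR; rewrite divr_gt0.
  (* The point y + R0 z0 lies on the segment from y to 0, closer to 0 by R0 / 4; the ball of radius
     R0 / 8 about it has norms at most |y| - sg. *)
  pose z0 := (- (4 * enorm y)^-1) *: y.
  have h : ((ga * m)%:E * lebn n B <= kern_mean u 1 1 y R0)%E.
    apply: (integral_ge_ball _ (8^-1 ^+ 2) (ga * m) z0).
    - apply: measurable_funM; last by apply: continuous_measurable_rV; exact: continuous_kern.
      exact: (measurableT_comp mu0 (measurable_affine_rV y R0)).
    - by move=> z; rewrite mulr_ge0 ?restrict_ball_ge0 ?kern_ge0.
    - by rewrite mulr_ge0// ltW.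
    move=> z; rewrite -enorm_lt_sqnorm ?invr_ge0// => z8.
    have x1 : enorm (y + R0 *: (z0 + z)) <= enorm y - sg.
      have -> : y + R0 *: (z0 + z) = (1 - R0 / (4 * enorm y)) *: y + R0 *: z.
        by apply/rowP => i; rewrite /z0 !mxE; ring.
      rewrite (le_trans (enormD _ _))// !enormZ (gtr0_norm R00).
      have q1 : R0 / (4 * enorm y) <= 1 by rewrite ler_pdivrMr ?mulr_gt0//; lra.
      rewrite ger0_norm ?subr_ge0// mulrBl mul1r.
      have -> : R0 / (4 * enorm y) * enorm y = R0 / 4 by field; rewrite gt_eqF.
      have : R0 * enorm z <= R0 * 8^-1 by rewrite ler_pM2l// ltW.
      by rewrite /sg; lra.
    have x2 : enorm (z0 + z) <= 2^-1.
      rewrite (le_trans (enormD _ _))// /z0 enormZ normrN ger0_norm ?invr_ge0 ?mulr_ge0 ?(ltW y0)//.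
      have -> : (4 * enorm y)^-1 * enorm y = 4^-1 by field; rewrite gt_eqF.
      by lra.
    rewrite patchE mem_set; last by rewrite /unit_ball/=; lra.
    apply: ler_pM => //; [exact: ltW|exact: uga|].
    rewrite kernE; apply: kprof_nondecreasing; rewrite divr1.
    by move: x2; rewrite enorm_le_sqnorm ?invr_ge0// expr2; lra.
  have := le_trans h (mean y yr); rewrite -(fineK Bfin) -/v -EFinM lee_fin => hv.
  apply: (@le_trans _ _ (m * v / I * ga)).
    by rewrite ler_wpM2r// /be ge_min lexx orbT.
  rewrite mulrAC ler_pdivrMr//; apply: le_trans hv.
  by rewrite le_eqVlt; apply/orP; left; apply/eqP; ring.
have [b bE] : exists b : R, ball_mean u s = b%:E.
  have := base 0; rewrite enorm0 => /(_ rho0 (divr_ge0 (ltW R00) (ler0n _ _))).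
  move: bm0; case: (ball_mean u s) => [b _ _| |]//; first by exists b.
  by move=> _; rewrite gt0_muley ?lte_fin// leye_eq.
have b0 : 0 <= b by rewrite -lee_fin -bE.
have {}base y : enorm y <= rho -> enorm y <= R0 / 4 -> c0 * b <= u y.
  by move=> y1 y2; rewrite -lee_fin EFinM -bE; exact: base.
have cb : 0 <= c0 * b by exact: mulr_ge0 (ltW c00) b0.
have be1 : be <= 1 by rewrite ge_min lexx.
clearbody c0 be.
rewrite bE => y yr; rewrite -EFinM lee_fin.
have key j : forall y, enorm y <= rho -> enorm y <= j%:R * sg -> be ^+ j * c0 * b <= u y.
  elim: j => [|j IH] {yr}y yr yj.
    rewrite expr0 mul1r; apply: base => //; rewrite (le_trans yj)// mul0r.
    by rewrite divr_ge0// ltW.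
  have [yR|yR] := leP (enorm y) (R0 / 4).
    apply: le_trans (base y yr yR); rewrite -mulrA ler_piMl//.
    by rewrite exprn_ile1// ltW.
  rewrite exprS -!mulrA; apply: step => //.
    by apply: mulr_ge0 => //; rewrite exprn_ge0// ltW.
  move=> x xy; rewrite mulrA; apply: IH; first by lra.
  by move: yj; rewrite -natr1; lra.
by apply: key => //; exact: le_trans yr Nrho.
Qed.

End lower_bounds.

(* Lebesgue measurable functions such as V need not be measurable for the Borel
   sigma-algebra that lebn is defined on. *)
Lemma nonmeasurable_le_integral {d} {T : measurableType d} {R : realType}
    (mu : {measure set T -> \bar R}) (D : set T) (f1 f2 : T -> \bar R) :
  (forall x, D x -> 0 <= f1 x <= f2 x)%E ->
  (\int[mu]_(x in D) f1 x <= \int[mu]_(x in D) f2 x)%E.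
Proof.
move=> f12; rewrite integral_mkcond [leRHS]integral_mkcond.
have h x : (0 <= (f1 \_ D) x <= (f2 \_ D) x)%E.
  by rewrite !patchE; case: ifPn => [/set_mem/f12//|_]; rewrite lexx.
rewrite !ge0_integralTE.
(* Both integrals are suprema over the simple functions below the integrand, so monotonicity is an
   inclusion of the sets of competitors. *)
- apply: ereal_sup_le => _ [k /= kf <-]; exists k => //= x.
  by rewrite (le_trans (kf x))//; have /andP[] := h x.
- by move=> x; have /andP[/le_trans] := h x; apply.
- by move=> x; have /andP[] := h x.
Qed.

(** * From weak solutions to supersolutions, and arithmetic of the exponents *)

Section solutions.
Context {R : realType} {n : nat}.

(** V enters the argument only here, through 0 <= V u^p <= b M^p; p >= 0 makes the power monotone in
    u. *)
Lemma is_solution_supersolution (b M eps : R) (V u : 'rV[R]_n -> R) :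
  0 <= b -> 0 <= critical_exponent R n - 1 - eps ->
  (forall x, unit_ball x -> 0 <= V x <= b) -> (forall x, unit_ball x -> u x <= M) ->
  is_solution eps V u ->
  exists g, supersolution (b * M `^ (critical_exponent R n - 1 - eps)) u g.
Proof.
set p := critical_exponent R n - 1 - eps => b0 p0 Vb uM [[cu /choice[g gP]] weak u_gt0 _].
exists g; split => //.
- by move=> i; have [] := gP i.
- by move=> i x Bx; have [_ /(_ x Bx)[dx gx]] := gP i; split.
- by rewrite mulr_ge0// powR_ge0.
move=> phi tphi phi0; rewrite weak//.
have ge0 x : unit_ball x -> 0 <= V x * u x `^ p * phi x.
  by move=> /Vb/andP[V0 _]; rewrite !mulr_ge0// powR_ge0.
apply/andP; split; first by apply: integral_ge0 => x Bx; rewrite lee_fin ge0.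
have mphi : measurable_fun (@unit_ball R n) (EFin \o phi).
  apply/measurable_EFinP/measurable_funTS; apply: continuous_measurable_rV.
  by have [/(_ [::])[]] := tphi.
rewrite -ge0_integralZl; last 4 first.
- exact: measurable_unit_ball.
- exact: mphi.
- by move=> x _; rewrite lee_fin.
- by rewrite lee_fin mulr_ge0// powR_ge0.
apply: nonmeasurable_le_integral => x Bx; rewrite lee_fin ge0//= -EFinM lee_fin.
have /andP[V0 Vxb] := Vb x Bx.
rewrite ler_wpM2r// ler_pM ?powR_ge0//.
by apply: ge0_ler_powR => //; rewrite ?nnegrE ?(ltW (u_gt0 x Bx))// ?uM//
  (le_trans (ltW (u_gt0 x Bx)))// uM.
Qed.

Lemma compact_unit_ball_enorm (K : set 'rV[R]_n) : compact K -> K `<=` unit_ball ->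
  exists2 rho : R, 0 <= rho < 1 & forall x, K x -> enorm x <= rho.
Proof.
move=> cK KB; have [K0|/set0P K0] := eqVneq K set0.
  by exists 0; [rewrite lexx ltr01|move=> x; rewrite K0].
have [|x /[!inE] Kx xP] := @compact_EVT_max _ R enorm K K0 cK.
  by apply: continuous_subspaceT; exact: continuous_enorm.
exists (enorm x); first by rewrite enorm_ge0; exact: KB.
by move=> z Kz; apply: xP; rewrite inE.
Qed.

End solutions.

(** If M >= 1, then M0^8 <= 1 and M^(e m) <= M^8; if M < 1, then M0^8 <= M^8 and M^(e m) <= 1. *)
Lemma power_lower_bound {R : realType} (M0 M e : R) (m : nat) :
  0 < M0 <= 1 -> M0 <= M -> 0 <= e -> e * m%:R <= 8 ->
  M0 ^+ 8 * (M `^ e) ^+ m <= M ^+ 8.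
Proof.
move=> /andP[M00 M01] M0M e0 em; have Mgt0 : 0 < M by exact: lt_le_trans M0M.
have M0' : 0 <= M0 := ltW M00.
have M' : 0 <= M := ltW Mgt0.
have -> : (M `^ e) ^+ m = M `^ (e * m%:R) by rewrite powRrM powR_mulrn ?powR_ge0.
have [M1|M1] := leP 1 M.
  rewrite -(powR_mulrn 8 M') -[leRHS]mul1r ler_pM ?exprn_ge0 ?powR_ge0 ?exprn_ile1//.
  exact: ler_powR.
rewrite -[leRHS]mulr1 ler_pM ?exprn_ge0 ?powR_ge0//.
  by apply: lerXn2r; rewrite ?nnegrE.
have M_le1 : 0 < M <= 1 by rewrite Mgt0 ltW.
by have := ger_powR M_le1 (mulr_ge0 e0 (ler0n R m)); rewrite powRr0.
Qed.

(** For M < 1 one has M^e <= M^e0, and 1 <= D M^e0 is solved for M. The bound is free of e, which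
    keeps the final constant independent of eps. *)
Lemma base_lower_bound {R : realType} (D e0 e M : R) :
  0 < D -> 0 < e0 <= e -> 0 < M -> 1 <= D * M `^ e ->
  Num.min 1 (D^-1 `^ e0^-1) <= M.
Proof.
move=> D0 /andP[e00 e0e] M_gt0 DM; have [M1|M1] := leP 1 M.
  by rewrite ge_min M1.
rewrite ge_min; apply/orP; right.
have -> : M = (M `^ e0) `^ e0^-1 by rewrite -powRrM divff ?gt_eqF// powRr1 ?ltW.
apply: ge0_ler_powR; rewrite ?nnegrE ?invr_ge0 ?powR_ge0 ?(ltW D0) ?(ltW e00)//.
have h : M `^ e <= M `^ e0 by apply: ger_powR => //; rewrite M_gt0 ltW.
rewrite -[leLHS]mulr1 mulrC ler_pdivrMr// mulrC.
by rewrite (le_trans DM)// ler_wpM2l// ltW.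
Qed.

(** Here e is p - 1, and e + eps = 4 / (n - 2): the restriction on eps leaves at least half of it.
    The upper bound 4 (1 + 1 / (n - 2)) for e (n - 1) equals 8 when n = 3. *)
Lemma critical_exponent_sub1 {R : realType} (n : nat) (eps : R) :
  (3 <= n)%N -> 0 <= eps < 2 / (n%:R - 2) ->
  let e := critical_exponent R n - 2 - eps in
  [/\ 0 < (2 / (n%:R - 2) : R), 2 / (n%:R - 2) <= e & e * n.-1%:R <= 8].
Proof.
move=> n3 /andP[eps0 eps2] /=.
have n2 : 1 <= n%:R - 2 :> R by have : 3 <= n%:R :> R; [rewrite ler_nat|lra].
have n2_gt0 : 0 < n%:R - 2 :> R by lra.
have n2_neq0 : n%:R - 2 != 0 :> R by rewrite gt_eqF.
have -> : critical_exponent R n - 2 = 2 * (2 / (n%:R - 2)).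
  by rewrite /critical_exponent; field.
have q0 : 0 < (2 / (n%:R - 2) : R) by rewrite divr_gt0.
split => //; first by lra.
have -> : n.-1%:R = n%:R - 1 :> R by rewrite -subn1 natrB//; case: (n) n3.
apply: (@le_trans _ _ (2 * (2 / (n%:R - 2)) * (n%:R - 1))).
  by rewrite ler_wpM2r//; lra.
have -> : 2 * (2 / (n%:R - 2)) * (n%:R - 1) = 4 * (1 + (n%:R - 2)^-1) :> R.
  by field.
have : (n%:R - 2 : R)^-1 <= 1 by rewrite invf_le1.
lra.
Qed.

Theorem theorem2 (R : realType) (n : nat) (hn : (3 <= n)%N)
    (b : R) (hb : 0 < b)
    (K : set 'rV[R]_n) (cK : compact K) (KB : K `<=` unit_ball) :
  exists c : R, 0 < c /\
    forall (eps : R) (V u : 'rV[R]_n -> R),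
      0 <= eps -> eps < 2 / (n%:R - 2) ->
      lebesgue_measurable_fun unit_ball V ->
      (forall x, unit_ball x -> 0 <= V x <= b) ->
      is_solution eps V u ->
      (c%:E <= ereal_sup [set (u x)%:E | x in unit_ball] ^+ 7 *
               ereal_inf [set (u x)%:E | x in K])%E.
Proof.
have n0 : (0 < n)%N by apply: leq_trans hn.
have n1 : (1 < n)%N by apply: leq_trans hn.
have [C C0 CP] := @supersolution_le_paraboloid R n n0.
have [c1 c10 c1P] := @ball_mean_lower R n C n1 C0.
have [rho rho01 rhoK] := compact_unit_ball_enorm K cK KB.
have [s [c2 [s01 c20 c2P]]] := @chain_lower R n rho rho01.
(* The lower bound for sup u that [base_lower_bound] extracts from M <= C A = C b M^(1 + e). *)
pose M0 : R := Num.min 1 ((C * b)^-1 `^ (2 / (n%:R - 2))^-1).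
have Cb : 0 < C * b by rewrite mulr_gt0.
have M00 : 0 < M0 by rewrite lt_min ltr01 powR_gt0// invr_gt0.
have M01 : M0 <= 1 by rewrite ge_min lexx.
exists (c2 * c1 * b^-1 ^+ n.-1 * M0 ^+ 8); split.
  by rewrite !mulr_gt0// exprn_gt0// invr_gt0.
move=> eps V u eps0 eps2 _ Vb solu.
have [q0 qe e8] := @critical_exponent_sub1 R n eps hn ltac:(by rewrite eps0).
set e := critical_exponent R n - 2 - eps in qe e8.
have e_gt0 : 0 < e by exact: lt_le_trans qe.
have pe : critical_exponent R n - 1 - eps = 1 + e by rewrite /e; ring.
have [[cu _] _ u_gt0 u_sphere] := solu.
have B0 : unit_ball (0 : 'rV[R]_n) by rewrite /unit_ball /= enorm0.
have [|x0 /[!inE] Dx0 x0P] := @compact_EVT_max _ R u closed_unit_ball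
    (ex_intro _ 0 (ltW B0)) (compact_closed_ball 1) .
  exact: cu.
have u0M : 0 < u x0.
  by apply: lt_le_trans (u_gt0 0 B0) (x0P 0 _); rewrite inE; exact: ltW.
have Bx0 : unit_ball x0.
  rewrite /unit_ball /= lt_neqAle Dx0 andbT; apply/eqP => /u_sphere ux0.
  by rewrite ux0 ltxx in u0M.
have uM x : unit_ball x -> u x <= u x0 by move=> Bx; apply: x0P; rewrite inE; exact: ltW.
have u_ge0 x : unit_ball x -> 0 <= u x by move=> /u_gt0/ltW.
have [|g ssu] := is_solution_supersolution b (u x0) eps V u (ltW hb) _ Vb uM solu.
  by rewrite pe addr_ge0// ltW.
rewrite pe in ssu.
set M := u x0 in u0M uM ssu.
have ME : M `^ (1 + e) = M * M `^ e.
  by rewrite powRD ?powRr1 ?ltW//; apply/implyP => _; rewrite gt_eqF.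
have Me : 0 < M `^ e by exact: powR_gt0.
set A := b * M `^ (1 + e) in ssu.
have A0 : 0 < A by rewrite mulr_gt0// powR_gt0.
have par := CP A u g ssu A0 u_ge0 u_sphere x0 Dx0.
have MM0 : M0 <= M.
  apply: (@base_lower_bound R (C * b) _ e) => //; first by rewrite q0.
  have : M * 1 <= M * (C * b * M `^ e).
    rewrite mulr1 (le_trans par)// /A ME.
    have -> : C * (b * (M * M `^ e)) = M * (C * b * M `^ e) by ring.
    rewrite ler_piMr ?mulr_ge0 ?powR_ge0 ?(ltW C0) ?(ltW hb) ?(ltW u0M)//.
    by rewrite gerBl sqnorm_ge0.
  by rewrite ler_pM2l.
have lowmean := c1P A u g ssu A0 u_ge0 x0 s u0M par s01.
pose m := c2 * (c1 * (M * (M / A) ^+ n.-1)).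
have m0 : 0 <= m by rewrite !mulr_ge0 ?exprn_ge0 ?divr_ge0 ?ltW.
have mK : (m%:E <= ereal_inf [set (u x)%:E | x in K])%E.
  apply: le_ereal_inf_tmp => _ [y Ky <-].
  apply: le_trans (c2P A u g ssu u_ge0 y (rhoK y Ky)).
  by rewrite EFinM lee_pmul2l ?lte_fin.
have supM : (M%:E <= ereal_sup [set (u x)%:E | x in unit_ball])%E.
  by apply: ereal_sup_ubound; exists x0.
have M7 : (0 <= M%:E)%E by rewrite lee_fin ltW.
(* Supremum and infimum are replaced by M and m, both nonnegative; for empty K the infimum is +oo
   and the bound still holds. *)
apply: (@le_trans _ _ ((M ^+ 7)%:E * m%:E)%E); last first.
  apply: lee_pmul => //; first by rewrite lee_fin exprn_ge0 ?ltW.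
  have lee_X k : ((M ^+ k)%:E <= ereal_sup [set (u x)%:E | x in unit_ball] ^+ k)%E.
    elim: k => [|k IHk]; first by rewrite expe0.
    by rewrite exprS EFinM expeS lee_pmul// lee_fin exprn_ge0 ?ltW.
  exact: lee_X.
rewrite -EFinM lee_fin /m.
(* As A = b M^(1 + e), the product M^7 m is a constant times M^8 / (M^e)^(n-1), the quantity that
   [power_lower_bound] controls. *)
have -> : M / A = b^-1 * (M `^ e)^-1.
  by rewrite /A ME; field; rewrite !gt_eqF.
have := @power_lower_bound R M0 M e n.-1 ltac:(by rewrite M00) MM0 (ltW e_gt0) e8.
rewrite -ler_pdivlMr ?exprn_gt0// => h.
have -> : M ^+ 7 * (c2 * (c1 * (M * (b^-1 * (M `^ e)^-1) ^+ n.-1))) =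
  c2 * c1 * b^-1 ^+ n.-1 * (M ^+ 8 / (M `^ e) ^+ n.-1).
  by rewrite exprMn !exprVn; ring.
by rewrite ler_wpM2l// !mulr_ge0 ?exprn_ge0 ?invr_ge0 ?ltW.
Qed.
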